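(* Let $\mathbf c:(0,1)\to(0,1)$ be a function with the finite restricted invertibility property (see context). Let $\mathcal F=\{f_i\}_{i\in I}\subseteq\mathbb H$ be $\ell_1$-localized with respect to the frame $\mathcal G=\{g_k\}_{k\in G}$ of the Hilbert space $\mathbb H$, and assume that $\|f\|\ge u>0$ for all $f\in\mathcal F$, that $\mathcal F$ is Bessel with Bessel bound $B_{\mathcal F}$, and that $0<D^-(\mathcal F;\mathcal G)\le D^+(\mathcal F;\mathcal G)<\infty$. Assume either (A) $\mathcal G=\{g_k:k\in G\}$ is a Riesz basis for $\mathbb H$ with Riesz bounds $A_{\mathcal G},B_{\mathcal G}$, or (B) $\mathcal G=\{g_k:k\in G\}$ is a frame for $\mathbb H$ whose dual frame $\widetilde{\mathcal G}=\{\widetilde g_k:k\in G\}$ is $\ell_1$-self-localized. Then for all $\epsilon,\delta\in(0,1)$ there is a subfamily $\mathcal F_{\epsilon\delta}\subseteq\mathcal F$ of uniform density with respect to $\mathcal G$ such that (1) $\displaystyle R^+(\mathcal F_{\epsilon\delta},\mathcal F;\mathcal G)=\frac{D(\mathcal F_{\epsilon\delta};\mathcal G)}{D^-(\mathcal F;\mathcal G)}\ge\frac{(1-\epsilon)u^2}{B_{\mathcal F}}$; (2) $\mathcal F_{\epsilon\delta}$ is a Riesz sequence with lower and upper Riesz bounds $\mathbf c(\epsilon)(1-\delta)\frac{A_{\mathcal G}}{B_{\mathcal G}}u^2$ and $B_{\mathcal F}$ in case (A), and $\mathbf c(\epsilon)(1-\delta)u^2$ and $B_{\mathcal F}$ in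 case (B).
   Context: Finite restricted invertibility property of $\mathbf c$: $\mathbf c:(0,1)\to(0,1)$ is continuous and monotone, and for every $\epsilon\in(0,1)$, $n\in\mathbb N$, $u>0$, orthonormal basis $\{e_i\}_{i=1}^n$ of $\ell_2^n$ and linear operator $T:\ell_2^n\to\ell_2^n$ with $\|Te_i\|\ge u$ for all $i$, there is $J_\epsilon\subseteq\{1,\dots,n\}$ with $|J_\epsilon|/n\ge(1-\epsilon)u^2/\|T\|^2$ and $\|\sum_{j\in J_\epsilon}b_jTe_j\|^2\ge\mathbf c(\epsilon)u^2\sum_{j\in J_\epsilon}|b_j|^2$ for all scalars $b_j$. (Such a function exists.) $I$ is a countable index set and $G=\mathbb Z^{d_1}\times\mathbb Z_{N_1}\times\cdots\times\mathbb Z_{N_{d_2}}$ with $d_1,d_2\in\mathbb N$, where $\mathbb Z_N=\{0,1,\dots,N-1\}$ is the cyclic group of order $N$. For $k\in G$, $R>0$ put $B_R(k)=\{g\in G:\|g-k\|_\infty=\max_{1\le j\le d_1+d_2}|g(j)-k(j)|\le R\}$. Frames: $\{f_i\}_{i\in I}\subseteq\mathbb H$ is a frame with bounds $0<A\le B<\infty$ if $A\|f\|^2\le\sum_i|\langle f,f_i\rangle|^2\le B\|f\|^2$ for all $f\in\mathbb H$; it is Bessel with Bessel bound $B$ if the right-hand inequality holds. The frame operator is $Sf=\sum_i\langle f,f_i\rangle f_i$, and the dual frame is $\{S^{-1}f_i\}_{i\in I}$. A Riesz sequence with Riesz bounds $0<A\le B<\infty$ is a family with $A\sum|a_i|^2\le\|\sum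 a_if_i\|^2\le B\sum|a_i|^2$ for all square-summable scalars; a Riesz basis is a Riesz sequence with dense linear span. Localization: $\mathcal F$ is $\ell_1$-localized with respect to $\mathcal G=\{g_k\}_{k\in G}$ if there is $r\in\ell_1(G)$ such that for each $f\in\mathcal F$ there is $k\in G$ with $|\langle f,g_n\rangle|\le r(n-k)$ for all $n\in G$. A frame $\mathcal G=\{g_k\}_{k\in G}$ is $\ell_1$-self-localized if there is $r\in\ell_1(G)$ with $|\langle g_k,g_{k'}\rangle|\le r(k-k')$ for all $k,k'\in G$. Density (sums over $f\in\mathcal F$ are over the indexed family, i.e. counted with multiplicity): with $a_f=\big(\sum_{n\in G}|\langle f,g_n\rangle|^2\big)^{-1}$, $$D^-(\mathcal F;\mathcal G)=\liminf_{R\to\infty}\inf_{k\in G}\frac{\sum_{f\in\mathcal F}a_f\sum_{n\in B_R(k)}|\langle f,g_n\rangle|^2}{|B_R(0)|},\quad D^+(\mathcal F;\mathcal G)=\limsup_{R\to\infty}\sup_{k\in G}\frac{\sum_{f\in\mathcal F}a_f\sum_{n\in B_R(k)}|\langle f,g_n\rangle|^2}{|B_R(0)|}.$$ If both agree, $\mathcal F$ has uniform density with respect to $\mathcal G$, with value $D(\mathcal F;\mathcal G)$. For $\mathcal F'\subseteq\mathcal F$ (with $0<D^-(\mathcal F;\mathcal G)\le D^+(\mathcal F;\mathcal G)<\infty$), the relative upper density is $R^+(\mathcal F',\mathcal F;\mathcal G)=D^+(\mathcal F';\mathcal G)/D^-(\mathcal F;\mathcal G)$. *)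

(* Defs.v *)
From HB Require Import structures.
From mathcomp Require Import all_boot all_order all_algebra finmap.
From mathcomp Require Import all_classical all_reals all_analysis.
From mathcomp Require Import complex.
From mathcomp Require summability.

Set Implicit Arguments.
Unset Strict Implicit.
Unset Printing Implicit Defensive.

Import Order.TTheory GRing.Theory Num.Theory.
Import numFieldNormedType.Exports.

Local Open Scope classical_set_scope.
Local Open Scope ring_scope.

(* Hilbert spaces are over the real or the complex numbers. *)
Variant scalar_kind := RealScalars | ComplexScalars.

Definition scalars (R : realType) (s : scalar_kind) : numFieldType :=
  match s with RealScalars => R | ComplexScalars => R[i] end.

Definition sconj (R : realType) (s : scalar_kind) :
    involutive_rmorphism (scalars R s) :=
  match s with RealScalars => idfun | ComplexScalars => Num.conj end.

Definition sre (R : realType) (s : scalar_kind) : scalars R s -> R :=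
  match s with RealScalars => id | ComplexScalars => @complex.Re R end.

(* The norm of a [normedModType] takes its values in the scalar field;
   [rnorm] is the same norm as an element of [R]. *)
Definition rnorm (R : realType) (s : scalar_kind)
  (V : normedModType (scalars R s)) (x : V) : R := sre `|x|.

Definition rabs (R : realType) (s : scalar_kind) (z : scalars R s) : R :=
  sre `|z|.

Section FiniteRestrictedInvertibility.
Context (R : realType) (s : scalar_kind).
Local Notation K := (scalars R s).

Definition l2dot n (x y : 'cV[K]_n) : K := \sum_(i < n) x i 0 * sconj R s (y i 0).

Definition l2norm n (x : 'cV[K]_n) : R :=
  Num.sqrt (\sum_(i < n) rabs (x i 0) ^+ 2).

Definition opnorm n (T : 'cV[K]_n -> 'cV[K]_n) : R :=
  sup [set l2norm (T x) | x in [set x | l2norm x <= 1]].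

(* [n] orthonormal vectors in dimension [n] form a basis. *)
Definition orthonormal_basis n (e : 'I_n -> 'cV[K]_n) : Prop :=
  forall i j, l2dot (e i) (e j) = (i == j)%:R.

Definition finite_restricted_invertibility (c : R -> R) : Prop :=
  [/\ {in `]0, 1[, forall x, c x \in `]0, 1[},
      {in `]0, 1[, continuous c},
      {in `]0, 1[ &, {homo c : x y / x <= y}} \/
      {in `]0, 1[ &, {homo c : x y /~ x <= y}} &
      forall (eps : R) (n : nat) (u : R) (e : 'I_n -> 'cV[K]_n)
        (T : {linear 'cV[K]_n -> 'cV[K]_n}),
      0 < eps < 1 -> (0 < n)%N -> 0 < u -> orthonormal_basis e ->
      (forall i, u <= l2norm (T (e i))) ->
      exists J : {set 'I_n},
        (1 - eps) * u ^+ 2 / opnorm T ^+ 2 <= #|J|%:R / n%:R /\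
        forall b : 'I_n -> K,
          c eps * u ^+ 2 * (\sum_(j in J) rabs (b j) ^+ 2)
            <= l2norm (\sum_(j in J) b j *: T (e j)) ^+ 2].

End FiniteRestrictedInvertibility.

(* The product of the cyclic groups of orders [N j]; the predecessor-successor
   makes the orders syntactically positive, as the group structure on ordinals
   requires, and is the identity since all [N j] are assumed positive. *)
Definition cyclics (d : nat) (N : 'I_d -> nat) :=
  {dffun forall j : 'I_d, 'I_(N j).-1.+1}.

HB.instance Definition _ d (N : 'I_d -> nat) := Choice.on (cyclics N).

Section CyclicsGroup.
Context (d : nat) (N : 'I_d -> nat).
Implicit Types x y z : cyclics N.

Definition cyclics_zero : cyclics N := [ffun j => 0].
Definition cyclics_opp x : cyclics N := [ffun j => - x j].
Definition cyclics_add x y : cyclics N := [ffun j => x j + y j].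

Lemma cyclics_addA : associative cyclics_add.
Proof. by move=> x y z; apply/ffunP => j; rewrite !ffunE addrA. Qed.

Lemma cyclics_addC : commutative cyclics_add.
Proof. by move=> x y; apply/ffunP => j; rewrite !ffunE addrC. Qed.

Lemma cyclics_add0 : left_id cyclics_zero cyclics_add.
Proof. by move=> x; apply/ffunP => j; rewrite !ffunE add0r. Qed.

Lemma cyclics_addN : left_inverse cyclics_zero cyclics_opp cyclics_add.
Proof. by move=> x; apply/ffunP => j; rewrite !ffunE addNr. Qed.

HB.instance Definition _ := GRing.isZmodule.Build (cyclics N)
  cyclics_addA cyclics_addC cyclics_add0 cyclics_addN.

End CyclicsGroup.

Definition index_group (d1 d2 : nat) (N : 'I_d2 -> nat) : zmodType :=
  ({ffun 'I_d1 -> int} * cyclics N)%type.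

(* The coordinates in the cyclic factors are compared through their
   representatives in {0, ..., N_j - 1}. *)
Definition sup_dist d1 d2 (N : 'I_d2 -> nat) (g k : index_group d1 N) : nat :=
  maxn (\max_(j < d1) `|g.1 j - k.1 j|)
       (\max_(j < d2) `|(g.2 j)%:Z - (k.2 j)%:Z|).

Definition gball (R : realType) d1 d2 (N : 'I_d2 -> nat) (r : R)
    (k : index_group d1 N) : set (index_group d1 N) :=
  [set g | (sup_dist g k)%:R <= r].

Definition gball_card (R : realType) d1 d2 (N : 'I_d2 -> nat) (r : R) : \bar R :=
  (\esum_(n in gball r (0%R : index_group d1 N)) 1)%E.

Section Families.
Context (R : realType) (s : scalar_kind).
Local Notation K := (scalars R s).
Context (H : completeNormedModType K) (dot : {dot H for sconj R s}).

Definition l2_mass (T : choiceType) (x : H) (f : T -> H) : \bar R :=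
  (\esum_(i in [set: T]) (rabs (dot x (f i)) ^+ 2)%:E)%E.

Definition bessel (T : choiceType) (f : T -> H) (B : R) : Prop :=
  forall x, (l2_mass x f <= (B * rnorm x ^+ 2)%:E)%E.

Definition frame_with_bounds (T : choiceType) (f : T -> H) (A B : R) : Prop :=
  [/\ 0 < A, A <= B,
      forall x, ((A * rnorm x ^+ 2)%:E <= l2_mass x f)%E & bessel f B].

Definition is_frame (T : choiceType) (f : T -> H) : Prop :=
  exists A B, frame_with_bounds f A B.

(* Unconditional sums, as limits along the finite subsets of the index set. *)
Definition frame_operator (T : choiceType) (f : T -> H) (x : H) : H :=
  summability.sum (fun i => dot x (f i) *: f i).

(* The frame operator of a frame is bijective, so that [xget] selects the
   unique preimage. *)
Definition dual_frame (T : choiceType) (f : T -> H) (k : T) : H :=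
  xget 0 [set y | frame_operator f y = f k].

Definition riesz_sequence (T : choiceType) (f : T -> H) (A B : R) : Prop :=
  [/\ 0 < A, A <= B &
      forall a : T -> K,
      let S := (\esum_(i in [set: T]) (rabs (a i) ^+ 2)%:E)%E in
      (S < +oo)%E ->
      exists x : H,
        [/\ summability.partial_sum (fun i => a i *: f i)
              @ summability.totally --> x,
            (A%:E * S <= (rnorm x ^+ 2)%:E)%E &
            ((rnorm x ^+ 2)%:E <= B%:E * S)%E]].

Definition linear_span (T : choiceType) (f : T -> H) : set H :=
  [set x | exists (A : {fset T}) (a : T -> K), x = \sum_(i <- A) a i *: f i].

Definition riesz_basis (T : choiceType) (f : T -> H) (A B : R) : Prop :=
  riesz_sequence f A B /\ dense (linear_span f).

Context (d1 d2 : nat) (N : 'I_d2 -> nat).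
Local Notation G := (index_group d1 N).

Definition l1_localized (T : choiceType) (f : T -> H) (g : G -> H) : Prop :=
  exists2 r : G -> R, summable [set: G] (fun n => (r n)%:E) &
    forall i, exists k, forall n, rabs (dot (f i) (g n)) <= r (n - k).

Definition l1_self_localized (g : G -> H) : Prop :=
  exists2 r : G -> R, summable [set: G] (fun n => (r n)%:E) &
    forall k k', rabs (dot (g k) (g k')) <= r (k - k').

Definition ball_average (T : choiceType) (f : T -> H) (g : G -> H)
    (r : R) (k : G) : \bar R :=
  ((\esum_(i in [set: T])
      ((l2_mass (f i) g)^-1 *
       \esum_(n in gball r k) (rabs (dot (f i) (g n)) ^+ 2)%:E))
   / gball_card d1 N r)%E.

Definition lower_density (T : choiceType) (f : T -> H) (g : G -> H) : \bar R :=
  limf_einf (fun r => ereal_inf (range (ball_average f g r))) +oo%R.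

Definition upper_density (T : choiceType) (f : T -> H) (g : G -> H) : \bar R :=
  limf_esup (fun r => ereal_sup (range (ball_average f g r))) +oo%R.

Definition has_uniform_density (T : choiceType) (f : T -> H) (g : G -> H)
    (D : \bar R) : Prop :=
  lower_density f g = D /\ upper_density f g = D.

Definition subfamily (T : choiceType) (f : T -> H) (J : set T) : J -> H :=
  fun i => f (val i).

Definition relative_upper_density (T : choiceType) (f : T -> H) (g : G -> H)
    (J : set T) : \bar R :=
  (upper_density (@subfamily T f J) g / lower_density f g)%E.

End Families.

Arguments subfamily {R s H T} f J.

(* Main.v *)
Require Import Defs.
From HB Require Import structures.
From mathcomp Require Import all_boot all_order all_algebra finmap.
From mathcomp Require Import all_classical all_reals all_analysis.
From mathcomp Require Import complex.
From mathcomp Require summability.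
From mathcomp Require Import ring lra zify.

(** Localization attaches to every element f_i a point kappa_i of the group and
    a summable r with |<f_i, g_n>| <= r (n - kappa_i). The proof rests on two
    consequences of this.

    First, densities count localization points. The normalized mass of f_i is
    concentrated near kappa_i, uniformly in i, so up to boundary effects the
    mass in a large ball is the number of the kappa_i in that ball
    ([mass_in_le], [mass_in_ge]).

    Second, elements that are localized far apart are almost orthogonal for a
    quadratic form q comparable to the squared norm ([almost_orthogonal]): the
    interaction of f_i and f_j is at most rho (kappa_i - kappa_j) with rho
    summable. For a Riesz basis, q x is the sum of the |<x, g_n>|^2
    ([almost_orthogonal_mass]); it lies between AG |x|^2 and BG |x|^2, which
    is where the factor AG / BG comes from. For a frame with self-localized
    dual, expanding in the dual frame bounds <f_i, f_j> itself
    ([dual_gram_le]), and q is the squared norm.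

    The group is cut into congruent cubic tiles. In each tile only the elements
    at depth at least L are considered; by the lower density, large tiles have
    almost the expected number of them ([count_of_lower_mass]). Finitely many
    vectors live isometrically in a Euclidean space, so finite restricted
    invertibility, for some eps' slightly smaller than eps, selects the
    proportion (1 - eps') u^2 / BF of them with lower Riesz bound c(eps') u^2
    ([finite_restricted_invertibility_seq]). The gain from eps' outweighs the
    discarded layers, so the same number of elements can be kept in every tile
    ([tile_selection]), and equal numbers in all tiles make the density of the
    selected family uniform ([tiled_mass]). Elements kept in different tiles are
    more than L apart, so by Schur's test ([far_pairs_le]) the tiles interact
    by an arbitrarily small multiple of the sum of the squared coefficients.
    Since c is continuous, the factor 1 - delta absorbs this loss and the one
    from c(eps) to c(eps'). The upper Riesz bound is the Bessel bound. *)

Set Implicit Arguments.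
Unset Strict Implicit.
Unset Printing Implicit Defensive.

Import Order.TTheory GRing.Theory Num.Theory.
Import numFieldNormedType.Exports.

Local Open Scope classical_set_scope.
Local Open Scope ring_scope.

(** * Sums of nonnegative families *)

Section Esum.
Context (R : realType).
Local Open Scope ereal_scope.

Section OneType.
Context (T : choiceType).
Implicit Types (D : set T) (phi psi : T -> \bar R) (l : seq T).

Lemma esum_seq l phi : uniq l -> (forall i, i \in l -> 0 <= phi i) ->
  \esum_(i in [set` l]) phi i = \sum_(i <- l) phi i.
Proof.
move=> ul phi0; rewrite esum_fset//; last by move=> i; rewrite inE => /phi0.
by rewrite [RHS]fsbig_seq.
Qed.

Lemma sum_le_esum D l phi : uniq l -> (forall i, i \in l -> D i) ->
  \sum_(i <- l) phi i <= \esum_(i in D) phi i.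
Proof.
move=> ul lD; apply: esum_ge; exists [set` l]; last by rewrite fsbig_seq.
by split => //.
Qed.

Lemma esum_le_seq D phi C :
  (forall l, uniq l -> (forall i, i \in l -> D i) ->
    \sum_(i <- l) phi i <= C) -> \esum_(i in D) phi i <= C.
Proof.
move=> h; apply: ge_ereal_sup => _ [X [finX XD] <-].
rewrite fsbig_finite//; apply: h; first exact: fset_uniq.
by move=> i; rewrite in_fset_set// inE => /XD.
Qed.

Lemma subset_esum D D' phi : D `<=` D' -> (forall i, D' i -> 0 <= phi i) ->
  \esum_(i in D) phi i <= \esum_(i in D') phi i.
Proof.
move=> DD' phi0; apply: esum_le_seq => l ul lD; apply: sum_le_esum => // i il.
exact/DD'/lD.
Qed.

Let esumZl_le D (c : R) phi : (0 <= c)%R -> (forall i, D i -> 0 <= phi i) ->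
  \esum_(i in D) (c%:E * phi i) <= c%:E * \esum_(i in D) phi i.
Proof.
move=> c0 phi0; apply: esum_le_seq => l ul lD.
rewrite big_seq -ge0_sume_distrr; last by move=> i /lD /phi0.
by rewrite -big_seq lee_wpmul2l// sum_le_esum.
Qed.

Lemma esumZl D (c : R) phi : (0 <= c)%R -> (forall i, D i -> 0 <= phi i) ->
  \esum_(i in D) (c%:E * phi i) = c%:E * \esum_(i in D) phi i.
Proof.
move=> c0 phi0; have [->|c1] := eqVneq c 0%R.
  by rewrite mul0e esum1// => i _; rewrite mul0e.
have c_gt0 : (0 < c)%R by rewrite lt_def c1.
apply/eqP; rewrite eq_le esumZl_le//=.
rewrite -(@lee_pmul2l _ c^-1%:E)//; last by rewrite lte_fin invr_gt0.
rewrite muleA -EFinM mulVf// mul1e.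
have -> : \esum_(i in D) phi i = \esum_(i in D) (c^-1%:E * (c%:E * phi i)).
  by apply: eq_esum => i _; rewrite muleA -EFinM mulVf// mul1e.
apply: esumZl_le; rewrite ?invr_ge0// => i Di.
by rewrite mule_ge0// ?phi0.
Qed.

(** The sum is a supremum of finite sums; a nearly optimal one leaves at most
    [eta] outside. *)
Lemma esum_tail phi (eta : R) : (forall i, 0 <= phi i) ->
  \esum_(i in [set: T]) phi i < +oo -> (0 < eta)%R ->
  exists l, \esum_(i in ~` [set` l]) phi i <= eta%:E.
Proof.
move=> phi0 phioo eta0.
have S0 : 0 <= \esum_(i in [set: T]) phi i by exact: esum_ge0.
have Sfin : \esum_(i in [set: T]) phi i \is a fin_num by rewrite ge0_fin_numE.
have [_ [X [finX _] <-] Xlt] := ub_ereal_sup_adherent eta0 Sfin.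
exists (fset_set X).
have {}Xlt : \esum_(i in [set: T]) phi i - eta%:E <
    \sum_(i <- fset_set X) phi i by rewrite -fsbig_finite.
have := esumID [set` fset_set X] setT phi (fun i _ => phi0 i).
rewrite !setTI esum_seq ?fset_uniq// => SE.
move: Xlt Sfin; rewrite SE.
have: 0 <= \sum_(i <- fset_set X) phi i by apply: sume_ge0.
have: 0 <= \esum_(i in ~` [set` fset_set X]) phi i by apply: esum_ge0.
case: (\sum_(i <- fset_set X) phi i) => [a||] //;
  case: (\esum_(i in _) _) => [b||] // _ _.
change ((a + b - eta)%:E < a%:E -> (a + b)%:E \is a fin_num -> b%:E <= eta%:E).
by rewrite lte_fin lee_fin => + _; lra.
Qed.

Lemma esum1_seq l : uniq l -> \esum_(i in [set` l]) 1 = (size l)%:R%:E :> \bar R.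
Proof.
move=> ul; rewrite esum_seq// sumEFin big_const_seq count_predT.
by rewrite iter_addr addr0.
Qed.

(** Cardinalities are sums of ones; a finite one comes with an enumeration. *)
Lemma esum1_fin D (C : R) : \esum_(i in D) 1 <= C%:E :> \bar R ->
  exists2 l, uniq l & forall i, (i \in l) = (i \in D).
Proof.
move=> DC; have finD : finite_set D.
  apply: contrapT => /(infinite_set_fset (Num.truncn C).+1)[X XD ltX].
  have := le_trans (@sum_le_esum D X (cst 1) (fset_uniq _) _) DC.
  rewrite sumEFin big_const_seq count_predT iter_addr addr0 lee_fin => h.
  have : ((Num.truncn C).+1%:R <= C :> R)%R.
    by apply: le_trans (h _); [rewrite ler_nat|exact: XD].
  by apply/negP; rewrite -ltNge truncnS_gt.
by exists (fset_set D) => [|i]; [exact: fset_uniq|rewrite in_fset_set].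
Qed.

End OneType.

Lemma exchange_esum (T U : choiceType) (D : set T) (E : set U)
    (phi : T -> U -> \bar R) : (forall i j, 0 <= phi i j) ->
  \esum_(i in D) \esum_(j in E) phi i j = \esum_(j in E) \esum_(i in D) phi i j.
Proof.
move=> phi0; rewrite !esum_esum//.
rewrite (reindex_esum (E `*`` (fun=> D)) _ (fun x => (x.2, x.1)))//.
split=> //=.
- by move=> [i j] /= [].
- by move=> [i j] [i' j'] _ _ [-> ->].
- by move=> [i j] /= [Di Ej]; exists (j, i).
Qed.

Lemma esum_finType (T : finType) (phi : T -> \bar R) :
  (forall i, 0 <= phi i) -> \esum_(i in [set: T]) phi i = \sum_(i : T) phi i.
Proof.
move=> phi0; rewrite -[RHS]esum_seq ?index_enum_uniq//.
by congr (esum _ _); apply/seteqP; split => // i _ /=; rewrite mem_index_enum.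
Qed.

Lemma esum_bij (T U : choiceType) (e : T -> U) (phi : U -> \bar R) :
  bijective e -> \esum_(j in [set: U]) phi j = \esum_(i in [set: T]) phi (e i).
Proof.
move=> be; apply: reindex_esum; split=> //.
- by move=> i j _ _; exact: bij_inj.
- by case: be => e' _ eK y _; exists (e' y).
Qed.

Lemma esum_if (T : choiceType) (P : pred T) (phi : T -> \bar R) :
  \esum_(i in [set: T]) (if P i then phi i else 0) =
  \esum_(i in [set i | P i]) phi i.
Proof.
rewrite [RHS]esum_mkcond; apply: eq_esum => i _.
by rewrite mem_setE.
Qed.

End Esum.

(** * Real parts and absolute values over both scalar fields *)

Section Scalars.
Context (R : realType) (s : scalar_kind).
Local Notation K := (scalars R s).
Implicit Types (z w : K) (x y : R).

(** The real numbers inside the field of scalars, where norms take their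
    values. *)
Definition emb x : K :=
  match s return scalars R s with
  | RealScalars => x | ComplexScalars => (x%:C)%C end.

Lemma sre_emb x : sre (emb x) = x.
Proof. by rewrite /emb /sre; case: s. Qed.

Lemma emb_sre z : 0 <= z -> emb (sre z) = z.
Proof.
rewrite /emb /sre; case: s z => //= z; case: z => a b.
by rewrite lecE /= => /andP[/eqP -> _].
Qed.

Lemma ler_emb x y : (emb x <= emb y) = (x <= y).
Proof. by rewrite /emb; case: s => //; rewrite lecR. Qed.

Lemma emb0 : emb 0 = 0. Proof. by rewrite /emb; case: s. Qed.

Lemma emb1 : emb 1 = 1. Proof. by rewrite /emb; case: s. Qed.

Lemma embM x y : emb (x * y) = emb x * emb y.
Proof. by rewrite /emb; case: s => //; rewrite rmorphM. Qed.

Lemma embD x y : emb (x + y) = emb x + emb y.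
Proof. by rewrite /emb; case: s => //; rewrite rmorphD. Qed.

Lemma ltr_emb x y : (emb x < emb y) = (x < y).
Proof. by rewrite /emb; case: s => //; rewrite ltcR. Qed.

Lemma sreD z w : sre (z + w) = sre z + sre w.
Proof. by rewrite /sre; case: s z w => //= -[a b] [a' b']. Qed.

Lemma sre0 : sre (0 : K) = 0.
Proof. by rewrite /sre; case: s. Qed.

Lemma sreN z : sre (- z) = - sre z.
Proof. by rewrite /sre; case: s z => //= -[a b]. Qed.

Lemma sre_sum (T : Type) (r : seq T) (P : pred T) (F : T -> K) :
  sre (\sum_(i <- r | P i) F i) = \sum_(i <- r | P i) sre (F i).
Proof.
by apply: (big_morph (fun z => sre z)) => [z w|]; rewrite ?sreD ?sre0.
Qed.

Lemma normr_emb z : `|z| = emb (rabs z).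
Proof. by rewrite /rabs emb_sre. Qed.

Lemma rabs_ge0 z : 0 <= rabs z.
Proof. by rewrite -ler_emb emb0 -normr_emb. Qed.

Lemma rabsM z w : rabs (z * w) = rabs z * rabs w.
Proof. by rewrite -[LHS]sre_emb -normr_emb normrM !normr_emb -embM sre_emb. Qed.

Lemma rabsD z w : rabs (z + w) <= rabs z + rabs w.
Proof.
rewrite -ler_emb -normr_emb; apply: (le_trans (ler_normD _ _)).
by rewrite !normr_emb embD.
Qed.

Lemma rabs0 : rabs (0 : K) = 0.
Proof. by rewrite /rabs normr0 sre0. Qed.

Lemma rabsN z : rabs (- z) = rabs z.
Proof. by rewrite /rabs normrN. Qed.

Lemma rabs_sum (T : Type) (r : seq T) (P : pred T) (F : T -> K) :
  rabs (\sum_(i <- r | P i) F i) <= \sum_(i <- r | P i) rabs (F i).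
Proof.
elim/big_ind2 : _ => [|z x w y zx wy|//]; first by rewrite rabs0.
by apply: (le_trans (rabsD _ _)); apply: lerD.
Qed.

Lemma mul_sconj z : z * sconj R s z = emb (rabs z ^+ 2).
Proof.
rewrite expr2 embM -normr_emb; case: s z => z /=; last by rewrite -expr2 normCK.
by rewrite -!expr2 real_normK ?num_real.
Qed.

Lemma sre_mul_sconj z : sre (z * sconj R s z) = rabs z ^+ 2.
Proof. by rewrite mul_sconj sre_emb. Qed.

Lemma rabs_sconj z : rabs (sconj R s z) = rabs z.
Proof. by rewrite /rabs; case: s z => z //=; exact: (congr1 (@complex.Re R) (norm_conjC _)). Qed.

Lemma sre_sconj z : sre (sconj R s z) = sre z.
Proof. by case: s z => //= -[a b]. Qed.

Lemma sre_le_rabs z : sre z <= rabs z.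
Proof.
case: s z => [z|[a b]] /=; first exact: ler_norm.
rewrite /rabs /= (le_trans (ler_norm _))// -sqrtr_sqr ler_wsqrtr//.
by rewrite lerDl sqr_ge0.
Qed.

Lemma sre_mul_emb x z : sre (emb x * z) = x * sre z.
Proof. by rewrite /emb /sre; case: s z => //= -[a b] /=; rewrite mul0r subr0. Qed.

Lemma rabs_emb x : 0 <= x -> rabs (emb x) = x.
Proof. by move=> x0; rewrite /rabs ger0_norm ?sre_emb// -emb0 ler_emb. Qed.

Lemma sconj_emb x : sconj R s (emb x) = emb x.
Proof. by rewrite /emb; case: s => //=; rewrite /Num.conj /= oppr0. Qed.

Lemma sconj0 : sconj R s 0 = 0.
Proof. by rewrite -emb0 sconj_emb. Qed.

End Scalars.
Arguments emb {R} s x.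

(** * Inner products *)

Section InnerProduct.
Context (R : realType) (s : scalar_kind).
Local Notation K := (scalars R s).
Context (H : completeNormedModType K) (dot : {dot H for sconj R s}).
Hypothesis dot_norm : forall x : H, `|x| ^+ 2 = dot x x.
Implicit Types x y z : H.

Lemma hnormE x : `|x| = emb s (rnorm x).
Proof. by rewrite /rnorm emb_sre. Qed.

Lemma rnorm_ge0 x : 0 <= rnorm x.
Proof. by rewrite -(ler_emb s) emb0 -hnormE. Qed.

Lemma rnormD x y : rnorm (x + y) <= rnorm x + rnorm y.
Proof.
rewrite -(ler_emb s) -hnormE (le_trans (ler_normD _ _))// !hnormE.
by rewrite embD.
Qed.

Lemma rnormN x : rnorm (- x) = rnorm x.
Proof. by rewrite /rnorm normrN. Qed.

Lemma rnormB x y : rnorm (x - y) = rnorm (y - x).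
Proof. by rewrite -rnormN opprB. Qed.

Lemma rnorm0 : rnorm (0 : H) = 0.
Proof. by rewrite /rnorm normr0 sre0. Qed.

Lemma rnormZ (a : K) x : rnorm (a *: x) = rabs a * rnorm x.
Proof.
rewrite -[LHS](sre_emb s) -hnormE normrZ hnormE normr_emb.
by rewrite -embM sre_emb.
Qed.

Lemma rnorm0_eq0 x : rnorm x = 0 -> x = 0.
Proof. by move=> x0; apply/normr0_eq0; rewrite hnormE x0 emb0. Qed.

Lemma dotxx x : dot x x = emb s (rnorm x ^+ 2).
Proof. by rewrite -dot_norm hnormE !expr2 embM. Qed.

Lemma rnorm_sqr x : rnorm x ^+ 2 = sre (dot x x).
Proof. by rewrite dotxx sre_emb. Qed.

Lemma dotC x y : dot x y = sconj R s (dot y x).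
Proof. by rewrite (hermitian_subproof x y) expr0 mul1r. Qed.

Lemma dotDl x y z : dot (x + y) z = dot x z + dot y z.
Proof. exact: linearDl. Qed.
Lemma dotDr x y z : dot x (y + z) = dot x y + dot x z.
Proof. exact: linearDr. Qed.
Lemma dotBl x y z : dot (x - y) z = dot x z - dot y z.
Proof. exact: linearBl. Qed.
Lemma dotBr x y z : dot x (y - z) = dot x y - dot x z.
Proof. exact: linearBr. Qed.
Lemma dotNr x y : dot x (- y) = - dot x y.
Proof. exact: linearNr. Qed.
Lemma dotZl a x y : dot (a *: x) y = a * dot x y.
Proof. exact: linearZl_LR. Qed.
Lemma dotZr a x y : dot x (a *: y) = sconj R s a * dot x y.
Proof. exact: linearZr_LR. Qed.
Lemma dot_suml (T : Type) (r : seq T) (P : pred T) (F : T -> H) y :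
  dot (\sum_(i <- r | P i) F i) y = \sum_(i <- r | P i) dot (F i) y.
Proof. exact: linear_sumlz. Qed.
Lemma dot_sumr (T : Type) (r : seq T) (P : pred T) (F : T -> H) y :
  dot y (\sum_(i <- r | P i) F i) = \sum_(i <- r | P i) dot y (F i).
Proof. exact: linear_sumr. Qed.

Lemma rabs_dotC x y : rabs (dot x y) = rabs (dot y x).
Proof. by rewrite dotC rabs_sconj. Qed.

Lemma cauchy_schwarz x y : rabs (dot x y) <= rnorm x * rnorm y.
Proof.
have [y0|y0] := eqVneq (rnorm y) 0.
  by rewrite (rnorm0_eq0 y0) linear0r rabs0 rnorm0 mulr0.
have y_gt0 : 0 < rnorm y by rewrite lt_def y0 rnorm_ge0.
(* the part of x orthogonal to y, multiplied by <y, y> to avoid a division *)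
have := sqr_ge0 (rnorm (emb s (rnorm y ^+ 2) *: x - dot x y *: y)).
rewrite (rnorm_sqr (_ - _)) dotBl !dotBr !dotZl !dotZr.
rewrite !dotxx (dotC y x) !sreD !sreN.
set a := dot x y.
have -> : a * (sconj R s (emb s (rnorm y ^+ 2)) * sconj R s a) =
  sconj R s (emb s (rnorm y ^+ 2)) * (a * sconj R s a) by ring.
have -> : a * (sconj R s a * emb s (rnorm y ^+ 2)) =
  emb s (rnorm y ^+ 2) * (a * sconj R s a) by ring.
rewrite (mulrC (sconj R s a) a) sconj_emb mul_sconj -!embM !sre_emb.
rewrite subrr sre0 subr0 => h.
have : 0 <= rnorm y ^+ 2 * ((rnorm x * rnorm y) ^+ 2 - rabs a ^+ 2).
  by apply: (le_trans h); rewrite le_eqVlt; apply/orP; left; apply/eqP; ring.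
rewrite pmulr_rge0 ?exprn_gt0// subr_ge0 ler_sqr ?nnegrE ?rabs_ge0//.
by rewrite mulr_ge0 ?rnorm_ge0.
Qed.

Lemma rnormD_sqr x y :
  rnorm (x + y) ^+ 2 = rnorm x ^+ 2 + rnorm y ^+ 2 + 2 * sre (dot x y).
Proof.
rewrite !rnorm_sqr dotDl !dotDr !sreD (dotC y x) sre_sconj; ring.
Qed.

End InnerProduct.

(** * Unconditional convergence *)

#[local] Existing Instance summability.totally_filter.

Section Limits.
Context (R : realType) (s : scalar_kind).
Local Notation K := (scalars R s).
Context (H : completeNormedModType K).
Implicit Types x y z : H.

(** Radii of balls range over the field of scalars, whose positive elements are
    the embedded positive reals; limits can thus be handled with real radii. *)
Lemma rcvgP (T : Type) (F : set_system T) {FF : Filter F} (v : T -> H) x :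
  v @ F --> x <-> forall e : R, 0 < e -> \forall t \near F, rnorm (x - v t) < e.
Proof.
rewrite cvgrPdist_lt; split => [h e e0|h e e0].
  have /h : 0 < emb s e by rewrite -(emb0 R s) ltr_emb.
  by apply: filterS => t; rewrite hnormE ltr_emb.
have e_emb := emb_sre (ltW e0).
have /h : 0 < sre e by rewrite -(ltr_emb s) emb0 e_emb.
by apply: filterS => t; rewrite hnormE -{2}e_emb ltr_emb.
Qed.

Lemma rcauchy_cvg (T : Type) (F : set_system T) {FF : ProperFilter F}
    (v : T -> H) :
  (forall e : R, 0 < e -> exists x, \forall t \near F, rnorm (x - v t) < e) ->
  cvg (v @ F).
Proof.
move=> h; apply/cauchy_cvgP/cauchy_exP => e e0.
have e_emb := emb_sre (ltW e0).
have /h[x hx] : 0 < sre e by rewrite -(ltr_emb s) emb0 e_emb.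
exists x; move: hx; apply: filterS => t ht.
by rewrite -ball_normE /= hnormE -e_emb ltr_emb.
Qed.

Lemma cvg_rnorm (T : Type) (F : set_system T) {FF : Filter F} (v : T -> H) x :
  v @ F --> x -> (fun t => rnorm (v t)) @ F --> rnorm x.
Proof.
move=> /rcvgP vx; apply/cvgrPdist_lt => e /vx; apply: filterS => t.
apply: le_lt_trans; rewrite ler_norml; apply/andP; split.
  by have := rnormD (v t - x) x; rewrite subrK (rnormB (v t)) => ?; lra.
by have := rnormD (x - v t) (v t); rewrite subrK => ?; lra.
Qed.

Lemma cvg_rnorm_sqr (T : Type) (F : set_system T) {FF : Filter F}
    (v : T -> H) x :
  v @ F --> x -> (fun t => rnorm (v t) ^+ 2) @ F --> rnorm x ^+ 2.
Proof. by move=> /cvg_rnorm vx; rewrite expr2; apply: cvgM. Qed.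

Lemma totallyP (T : choiceType) (P : {fset T} -> Prop) :
  (\forall A \near summability.totally, P A) <->
  exists A0 : {fset T}, forall A, (A0 `<=` A)%fset -> P A.
Proof. by split=> [[A0 _ h]|[A0 h]]; exists A0. Qed.

Lemma partial_sumE (T : choiceType) (V : zmodType) (v : T -> V) (A : {fset T}) :
  summability.partial_sum v A = \sum_(i <- A) v i.
Proof. by rewrite big_seq_fsetE. Qed.

(** An upper bound on the finite sums makes them Cauchy along the finite
    subsets, since it applies to the difference of two partial sums. *)
Lemma synth_cvg (T : choiceType) (f : T -> H) (B : R) (a : T -> K) : 0 < B ->
  (forall l : seq T, uniq l -> rnorm (\sum_(i <- l) a i *: f i) ^+ 2 <=
    B * (\sum_(i <- l) rabs (a i) ^+ 2)) ->
  (\esum_(i in [set: T]) (rabs (a i) ^+ 2)%:E < +oo)%E ->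
  cvg (summability.partial_sum (fun i => a i *: f i) @ summability.totally).
Proof.
move=> B0 h Soo.
have phi0 i : (0 <= (rabs (a i) ^+ 2)%:E)%E by rewrite lee_fin sqr_ge0.
apply: rcauchy_cvg => e e0.
have eta0 : 0 < e ^+ 2 / (2 * B).
  by rewrite divr_gt0 ?exprn_gt0// mulr_gt0.
have [l hl] := esum_tail phi0 Soo eta0.
exists (\sum_(i <- [fset i in l]%fset) a i *: f i).
apply/totallyP; exists [fset i in l]%fset => X lX.
rewrite partial_sumE rnormB.
have -> : \sum_(i <- X) a i *: f i - \sum_(i <- [fset i in l]%fset) a i *: f i
   = \sum_(i <- (X `\` [fset i in l])%fset) a i *: f i.
  rewrite (big_fsetID _ [pred i | i \in l])/=.
  have -> : [fset x0 in X | x0 \in l]%fset = [fset i in l]%fset.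
    apply/fsetP => i; rewrite !inE andbC; case: (boolP (i \in l)) => //= il.
    by apply: (fsubsetP lX); rewrite !inE.
  rewrite [LHS]addrC addKr; congr (\sum_(i <- enum_fset _) _).
  by apply/fsetP => i; rewrite !inE andbC.
have hB := h (X `\` [fset i in l])%fset (fset_uniq _).
rewrite -(@ltr_pXn2r _ 2)// ?nnegrE ?rnorm_ge0 ?ltW//.
apply: (le_lt_trans hB).
have : \sum_(i <- (X `\` [fset i in l])%fset) rabs (a i) ^+ 2
    <= e ^+ 2 / (2 * B).
  rewrite -lee_fin -sumEFin; apply: le_trans hl.
  apply: sum_le_esum; first exact: fset_uniq.
  by move=> i; rewrite !inE => /andP[/negP il _] /=.
rewrite -(ler_pM2l B0) => /le_lt_trans; apply.
have -> : B * (e ^+ 2 / (2 * B)) = e ^+ 2 / 2 by field; rewrite gt_eqF.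
by rewrite ltr_pdivrMr// ltr_pMr ?exprn_gt0// ltr1n.
Qed.

(** Uniform bounds on the finite sums pass to all square-summable
    coefficients: the upper bound gives convergence, and both bounds are closed
    conditions. *)
Lemma riesz_sequence_finite (T : choiceType) (f : T -> H) (A B : R) :
  0 < A -> A <= B ->
  (forall (l : seq T) (a : T -> K), uniq l ->
    A * (\sum_(i <- l) rabs (a i) ^+ 2) <= rnorm (\sum_(i <- l) a i *: f i) ^+ 2
      <= B * (\sum_(i <- l) rabs (a i) ^+ 2)) ->
  riesz_sequence f A B.
Proof.
move=> A0 AB h; split => // a S Soo.
have phi0 i : (0 <= (rabs (a i) ^+ 2)%:E)%E by rewrite lee_fin sqr_ge0.
have B0 : 0 < B by apply: lt_le_trans AB.
have /cvg_ex[/= x vx] := synth_cvg B0 (fun l ul => proj2 (andP (h l a ul))) Soo.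
exists x; split => //.
  rewrite -(esumZl (ltW A0))//.
  apply: esum_le_seq => l ul _.
  rewrite sumEFin lee_fin -mulr_sumr.
  apply: (cvgr_to_ge (cvg_rnorm_sqr vx)).
  apply/totallyP; exists [fset i in l]%fset => X lX; rewrite partial_sumE.
  have /andP[+ _] := h X a (fset_uniq _); apply: le_trans.
  rewrite ler_pM2l// -lee_fin -!sumEFin -[leRHS](esum_seq (fset_uniq X))//.
  apply: sum_le_esum => // i il /=; apply: (fsubsetP lX); by rewrite !inE.
have Sfin : S \is a fin_num by rewrite ge0_fin_numE ?esum_ge0.
rewrite -(fineK Sfin) -EFinM lee_fin.
apply: (cvgr_to_le (cvg_rnorm_sqr vx)).
apply: nearW => X; rewrite partial_sumE.
have /andP[_ hX] := h X a (fset_uniq _); apply: (le_trans hX).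
rewrite ler_pM2l// -lee_fin fineK// -sumEFin.
by apply: sum_le_esum; rewrite ?fset_uniq.
Qed.

(** Coefficients on [J] are extended by zero, which keeps all indices in [T]
    and avoids sums over the subtype. *)
Lemma subfamily_riesz_sequence (T : choiceType) (f : T -> H) (J : set T)
    (A B : R) :
  0 < A -> A <= B ->
  (forall (l : seq T) (a : T -> K), uniq l -> (forall i, i \in l -> J i) ->
    A * (\sum_(i <- l) rabs (a i) ^+ 2) <= rnorm (\sum_(i <- l) a i *: f i) ^+ 2
      <= B * (\sum_(i <- l) rabs (a i) ^+ 2)) ->
  riesz_sequence (subfamily f J) A B.
Proof.
move=> A0 AB h; apply: riesz_sequence_finite => // l a ul.
pose b i : K := if @insub T (fun i => i \in J) J i is Some j then a j else 0.
have ba j : b (val j) = a j by rewrite /b valK.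
have := h [seq val j | j <- l] b.
rewrite (map_inj_uniq val_inj) !big_map => h1.
move: h1; under eq_bigr do rewrite ba.
under [X in rnorm X]eq_bigr do rewrite ba.
apply => // _ /mapP[j _ ->]; exact/set_mem/(valP j).
Qed.

End Limits.

(** * Bessel families and Riesz bases *)

Section HilbertFamilies.
Context (R : realType) (s : scalar_kind).
Local Notation K := (scalars R s).
Context (H : completeNormedModType K) (dot : {dot H for sconj R s}).
Hypothesis dot_norm : forall x : H, `|x| ^+ 2 = dot x x.
Context (T : choiceType) (f : T -> H).
Implicit Types (x y : H) (l : seq T) (a : T -> K).

(** Young's inequality in each term. Taking for [t] a Bessel or Riesz bound, it
    plays the role of the Cauchy-Schwarz inequality without square roots. *)
Lemma dot_synth_le x l a (t : R) : 0 < t ->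
  sre (dot x (\sum_(i <- l) a i *: f i)) <=
  t / 2 * (\sum_(i <- l) rabs (a i) ^+ 2) +
  (2 * t)^-1 * (\sum_(i <- l) rabs (dot x (f i)) ^+ 2).
Proof.
move=> t0; rewrite dot_sumr sre_sum !mulr_sumr -big_split /=.
apply: ler_sum => i _; apply: (le_trans (sre_le_rabs _)).
rewrite dotZr rabsM rabs_sconj.
set p := rabs (a i); set q := rabs (dot x (f i)).
have -> : t / 2 * p ^+ 2 + (2 * t)^-1 * q ^+ 2 =
    p * q + (2 * t)^-1 * (t * p - q) ^+ 2 by field; rewrite gt_eqF.
by rewrite lerDl mulr_ge0 ?sqr_ge0// invr_ge0 mulr_ge0 ?ltW.
Qed.

(** Synthesis is adjoint to analysis, so it has the same bound: pair the
    synthesized vector with itself and absorb half of its norm. *)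
Lemma synth_bound l (B : R) : 0 < B ->
  (forall x, \sum_(i <- l) rabs (dot x (f i)) ^+ 2 <= B * rnorm x ^+ 2) ->
  forall a, rnorm (\sum_(i <- l) a i *: f i) ^+ 2 <=
    B * \sum_(i <- l) rabs (a i) ^+ 2.
Proof.
move=> B0 hB a; set x := \sum_(i <- l) _.
have := dot_synth_le x l a B0; rewrite -rnorm_sqr// => h.
have : (2 * B)^-1 * (\sum_(i <- l) rabs (dot x (f i)) ^+ 2) <=
    (2 * B)^-1 * (B * rnorm x ^+ 2).
  by rewrite ler_wpM2l ?hB// invr_ge0 mulr_ge0 ?ltW.
have -> : (2 * B)^-1 * (B * rnorm x ^+ 2) = rnorm x ^+ 2 / 2.
  by field; rewrite gt_eqF.
lra.
Qed.

Lemma bessel_seq (B : R) l : bessel dot f B -> uniq l -> forall x,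
  \sum_(i <- l) rabs (dot x (f i)) ^+ 2 <= B * rnorm x ^+ 2.
Proof.
move=> fB ul x; rewrite -lee_fin -sumEFin; apply: le_trans (fB x).
exact: sum_le_esum.
Qed.

Lemma bessel_synth (B : R) l a : 0 < B -> bessel dot f B -> uniq l ->
  rnorm (\sum_(i <- l) a i *: f i) ^+ 2 <= B * \sum_(i <- l) rabs (a i) ^+ 2.
Proof. by move=> B0 fB ul; apply: synth_bound => // x; apply: bessel_seq. Qed.

(** For coefficients extended by zero, the limit in the definition is the
    finite sum. *)
Lemma riesz_sequence_seq (A B : R) l a : riesz_sequence f A B -> uniq l ->
  A * (\sum_(i <- l) rabs (a i) ^+ 2) <= rnorm (\sum_(i <- l) a i *: f i) ^+ 2
    <= B * (\sum_(i <- l) rabs (a i) ^+ 2).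
Proof.
case=> A0 AB h ul; pose b i := if i \in l then a i else 0.
have SE : (\esum_(i in [set: T]) (rabs (b i) ^+ 2)%:E)%E =
    (\sum_(i <- l) rabs (a i) ^+ 2)%:E.
  rewrite -sumEFin -esum_seq//; last by move=> *; rewrite lee_fin sqr_ge0.
  rewrite [RHS]esum_mkcond; apply: eq_esum => i _; rewrite /b mem_setE.
  by case: ifP => // _; rewrite rabs0 expr0n.
have [|x []] := h b; first by rewrite SE ltry.
rewrite SE -!EFinM !lee_fin => xb ? ?.
suff -> : \sum_(i <- l) a i *: f i = x by apply/andP.
apply: (@cvg_unique _ (@norm_hausdorff _ H)
  (summability.partial_sum (fun i => b i *: f i) @ summability.totally)) => //.
apply: cvg_near_cst; apply/totallyP; exists [fset i in l]%fset => X lX.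
rewrite partial_sumE (big_fsetID _ [pred i | i \in l])/= [X in _ + X]big1_seq.
  rewrite addr0; have -> : [fset i in X | i \in l]%fset = [fset i in l]%fset.
    apply/fsetP => i; rewrite !inE andbC; case: (boolP (i \in l)) => //= il.
    by apply: (fsubsetP lX); rewrite !inE.
  rewrite (perm_big l) /=; last first.
    by apply: uniq_perm => // i; rewrite !inE.
  by rewrite big_seq [RHS]big_seq; apply: eq_bigr => i il; rewrite /b il.
by move=> i; rewrite !inE => /= /andP[_ /negPf il]; rewrite /b il scale0r.
Qed.

(** The other direction of the duality: pair [x] with the synthesis of its own
    coefficients. *)
Lemma riesz_sequence_bessel (A B : R) : riesz_sequence f A B -> bessel dot f B.
Proof.
move=> fR x; apply: esum_le_seq => l ul _; rewrite sumEFin lee_fin.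
have [A0 AB _] := fR.
pose a i := dot x (f i).
have /andP[_] := riesz_sequence_seq a fR ul.
set y := \sum_(i <- l) _; set t := \sum_(i <- l) _ => yt.
have t_le : t <= rnorm x * rnorm y.
  apply: le_trans (cauchy_schwarz dot_norm _ _).
  apply: le_trans (sre_le_rabs _); rewrite dot_sumr sre_sum.
  by apply: ler_sum => i _; rewrite dotZr mulrC sre_mul_sconj.
have t0 : 0 <= t by apply: sumr_ge0 => i _; rewrite sqr_ge0.
have := rnorm_ge0 x; have := rnorm_ge0 y => y0 x0.
have : t ^+ 2 <= (B * rnorm x ^+ 2) * t.
  apply: (@le_trans _ _ ((rnorm x * rnorm y) ^+ 2)); first by rewrite ler_sqr ?nnegrE ?mulr_ge0.
  by rewrite exprMn [B * _]mulrC -[_ * B * t]mulrA ler_wpM2l ?sqr_ge0.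
rewrite le_eqVlt in t0; case/orP: t0 => [/eqP <- _|t0].
  by rewrite mulr_ge0 ?sqr_ge0// (le_trans (ltW A0)).
by rewrite expr2 ler_pM2r.
Qed.

(** With [t] small, this is the continuity of the mass that is needed to pass
    to the closure of a span. *)
Lemma l2_massD_le x y (B t : R) : 0 < t -> bessel dot f B ->
  (l2_mass dot (x + y)%R f <= (1 + t)%:E * l2_mass dot x f +
     ((1 + t^-1) * (B * rnorm y ^+ 2))%:E)%E.
Proof.
move=> t0 fB.
have ti0 : 0 < t^-1 by rewrite invr_gt0.
have nn z i : (0 <= (rabs (dot z (f i)) ^+ 2)%:E)%E by rewrite lee_fin sqr_ge0.
rewrite EFinM; apply: le_trans (leeD (lexx _) (lee_wpmul2l _ (fB y))); last first.
  by rewrite lee_fin; lra.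
have t1 : 0 <= 1 + t by lra.
have ti1 : 0 <= 1 + t^-1 by lra.
rewrite /l2_mass -(esumZl t1)// -(esumZl ti1)// -esumD//; last 2 first.
- by move=> i _; rewrite mule_ge0.
- by move=> i _; rewrite mule_ge0.
apply: le_esum => i _; rewrite -!EFinM -EFinD lee_fin dotDl.
set z := dot x _; set w := dot y _.
have zw := rabsD z w; have := rabs_ge0 (z + w).
have := rabs_ge0 z; have := rabs_ge0 w => w0 z0 zw0.
apply: (@le_trans _ _ ((rabs z + rabs w) ^+ 2)).
  by rewrite ler_sqr ?nnegrE ?addr_ge0.
have -> : (1 + t) * rabs z ^+ 2 + (1 + t^-1) * rabs w ^+ 2 =
    (rabs z + rabs w) ^+ 2 + t^-1 * (t * rabs z - rabs w) ^+ 2.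
  by field; rewrite gt_eqF.
by rewrite lerDl mulr_ge0 ?sqr_ge0 ?ltW.
Qed.

(** On the span, pair [x] with its own expansion and use the lower Riesz bound
    on the coefficients; density of the span extends the estimate. *)
Lemma riesz_basis_frame (A B : R) : riesz_basis f A B ->
  frame_with_bounds dot f A B.
Proof.
case=> fR fD; have fB := riesz_sequence_bessel fR.
have [A0 AB _] := fR; split => // x.
have spanE y : linear_span f y -> ((A * rnorm y ^+ 2)%:E <= l2_mass dot y f)%E.
  case=> [X [a yE]].
  have := dot_synth_le y X a A0; rewrite -yE -rnorm_sqr//.
  have /andP[+ _] := riesz_sequence_seq a fR (fset_uniq X); rewrite -yE.
  move=> h1 h2.
  apply: (@le_trans _ _ (\sum_(i <- X) (rabs (dot y (f i)) ^+ 2)%:E)%E); last first.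
    exact: sum_le_esum.
  rewrite sumEFin lee_fin; set q := \sum_(i <- X) rabs (dot _ _) ^+ 2 in h2 *.
  have : rnorm y ^+ 2 / 2 <= (2 * A)^-1 * q by lra.
  have A2 : 0 < 2 * A by rewrite mulr_gt0.
  by move=> /(ler_wpM2l (ltW A2)); rewrite [_ * (_^-1 * q)]mulrA mulfV ?gt_eqF//; lra.
have mass_fin : l2_mass dot x f \is a fin_num.
  rewrite ge0_fin_numE; first exact: le_lt_trans (fB x) (ltry _).
  by apply: esum_ge0 => i _; rewrite lee_fin sqr_ge0.
rewrite -(fineK mass_fin) lee_fin; set q := fine _.
have q0 : 0 <= q by apply/fine_ge0/esum_ge0 => i _; rewrite lee_fin sqr_ge0.
have B0 : 0 < B by apply: lt_le_trans AB.
have key t e : 0 < t -> 0 < e ->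
    A * (rnorm x - e) ^+ 2 <= (1 + t) * q + (1 + t^-1) * (B * e ^+ 2) \/
    rnorm x < e.
  move=> t0 e0.
  have [||y [xy ySp]] := fD (ball x (emb s e)).
  - by exists x; apply: ballxx; rewrite -(emb0 R s) ltr_emb.
  - exact: ball_open.
  move: xy; rewrite -ball_normE/= hnormE ltr_emb => xy.
  have [xe|xe] := leP e (rnorm x); [left|by right].
  have := spanE _ ySp; rewrite -[y](subrK x) addrC.
  move=> /le_trans/(_ (l2_massD_le _ _ t0 fB)).
  rewrite -(fineK mass_fin) -EFinM -EFinD lee_fin -/q addrC subrK => h.
  apply: le_trans (le_trans h _).
    rewrite ler_pM2l// ler_sqr ?nnegrE ?rnorm_ge0//; last by rewrite subr_ge0.
    by have := rnormD (x - y) y; rewrite subrK; lra.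
  rewrite lerD2l ler_wpM2l//; first by rewrite addr_ge0// invr_ge0 ltW.
  rewrite ler_pM2l// ler_sqr ?nnegrE ?rnorm_ge0 ?(ltW e0)//.
  by rewrite rnormB ltW.
have [x0|x0] := eqVneq (rnorm x) 0; first by rewrite x0 expr0n mulr0.
have x_gt0 : 0 < rnorm x by rewrite lt_def x0 rnorm_ge0.
apply/ler_addgt0Pr => d d0.
(* C bounds all error terms of key relative to t = e *)
pose C := 2 * A * rnorm x + q + 2 * B * (rnorm x + 1) + 1.
have C0 : 0 < C by rewrite /C; have := mulr_gt0 A0 x_gt0; have := mulr_gt0 B0 x_gt0; nra.
pose t := Num.min 1 (Num.min (rnorm x / 2) (d / C)).
have dC : 0 < d / C by rewrite divr_gt0.
have t0 : 0 < t by rewrite !lt_min ltr01 dC divr_gt0.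
have t1 : t <= 1 by rewrite ge_min lexx.
have tx : t <= rnorm x / 2 by rewrite !ge_min lexx orbT.
have td : t <= d / C by rewrite !ge_min lexx !orbT.
have tC : t * C <= d by rewrite -ler_pdivlMr.
have [h|] := key t t t0 t0; last by lra.
have E1 : (1 + t^-1) * (B * t ^+ 2) = B * t ^+ 2 + B * t.
  by field; rewrite gt_eqF.
rewrite E1 in h.
have : t ^+ 2 <= t by rewrite expr2; nra.
have : 0 <= A * t ^+ 2 by rewrite mulr_ge0 ?sqr_ge0 ?ltW.
rewrite /C in tC.
have := mulr_gt0 B0 x_gt0.
nra.
Qed.

End HilbertFamilies.

(** * Restricted invertibility for finite families of vectors *)

Section GramSchmidt.
Context (R : realType) (s : scalar_kind).
Local Notation K := (scalars R s).
Context (H : completeNormedModType K) (dot : {dot H for sconj R s}).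
Hypothesis dot_norm : forall x : H, `|x| ^+ 2 = dot x x.

Definition frame_sum (ws : seq H) (x : H) : H := \sum_(w <- ws) dot x w *: w.

Lemma frame_sumC ws x y : dot (frame_sum ws x) y = dot x (frame_sum ws y).
Proof.
rewrite dot_suml dot_sumr; apply: eq_bigr => w _.
by rewrite dotZl dotZr mulrC (dotC dot w) mulrC.
Qed.

(** Gram-Schmidt, with the invariant that [frame_sum] fixes the processed
    vectors and the orthonormal ones; this says at once that the latter are
    orthonormal up to zeros and that they span the former. *)
Lemma gram_schmidt (vs : seq H) :
  exists2 ws, size ws = size vs &
    forall x, x \in vs \/ x \in ws -> frame_sum ws x = x.
Proof.
elim: vs => [|v vs [ws sz wsP]]; first by exists [::] => // x [].
pose e := v - frame_sum ws v.
have eP w : w \in ws -> dot e w = 0.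
  by move=> wws; rewrite dotBl frame_sumC wsP ?subrr//; right.
pose w0 := emb s (rnorm e)^-1 *: e.
have w0w w : w \in ws -> dot w0 w = 0 by move=> /eP; rewrite dotZl => ->; rewrite mulr0.
have ww0 w : w \in ws -> dot w w0 = 0.
  by move=> /w0w h; rewrite (dotC dot) h sconj0.
have ew0 : dot e w0 *: w0 = e.
  have [e0|e0] := eqVneq (rnorm e) 0.
    by rewrite (rnorm0_eq0 e0) linear0l scale0r.
  rewrite /w0 dotZr dotxx// scalerA.
  rewrite sconj_emb -!embM.
  have -> : (rnorm e)^-1 * rnorm e ^+ 2 / rnorm e = 1 by field.
  by rewrite emb1 scale1r.
have w0K : dot w0 w0 *: w0 = w0.
  by rewrite {1}/w0 dotZl -scalerA ew0.
have fixed y : y \in vs \/ y \in ws -> dot y w0 *: w0 + frame_sum ws y = y.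
  move=> yP; rewrite wsP// -{1}(wsP y yP) frame_sumC.
  rewrite {1}/frame_sum big_seq big1 ?linear0r ?scale0r ?add0r// => w /w0w ->.
  by rewrite scale0r.
exists (w0 :: ws) => [|x xP]; first by rewrite /= sz.
rewrite /frame_sum big_cons -/(frame_sum ws x).
have frame_w0 : frame_sum ws w0 = 0.
  by rewrite /frame_sum big_seq big1// => w /w0w ->; rewrite scale0r.
move: xP; rewrite !inE => -[|] /orP[/eqP ->|xP];
  [|exact: fixed (or_introl _)| |exact: fixed (or_intror _)].
  have vE : v = e + frame_sum ws v by rewrite /e subrK.
  rewrite {1}vE dotDl frame_sumC frame_w0 linear0r addr0 ew0.
  by rewrite -vE.
by rewrite w0K frame_w0 addr0.
Qed.

Lemma frame_sum_lin ws (T : Type) (l : seq T) (a : T -> K) (f : T -> H) :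
  frame_sum ws (\sum_(i <- l) a i *: f i) =
  \sum_(i <- l) a i *: frame_sum ws (f i).
Proof.
rewrite /frame_sum; under eq_bigr do rewrite dot_suml scaler_suml.
rewrite exchange_big /=; apply: eq_bigr => i _; rewrite scaler_sumr.
by apply: eq_bigr => w _; rewrite dotZl scalerA.
Qed.

Lemma frame_sum_norm ws x : frame_sum ws x = x ->
  rnorm x ^+ 2 = \sum_(w <- ws) rabs (dot x w) ^+ 2.
Proof.
move=> xE; rewrite (rnorm_sqr dot_norm) -{2}xE dot_sumr sre_sum.
by apply: eq_bigr => w _; rewrite dotZr mulrC sre_mul_sconj.
Qed.

End GramSchmidt.

Section RestrictedInvertibility.
Context (R : realType) (s : scalar_kind).
Local Notation K := (scalars R s).
Context (H : completeNormedModType K) (dot : {dot H for sconj R s}).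
Hypothesis dot_norm : forall x : H, `|x| ^+ 2 = dot x x.
Context (c : R -> R) (c_fri : finite_restricted_invertibility s c).

Lemma l2norm_sqr n (x : 'cV[K]_n) : l2norm x ^+ 2 = \sum_i rabs (x i 0) ^+ 2.
Proof. by rewrite sqr_sqrtr// sumr_ge0// => i _; rewrite sqr_ge0. Qed.

(** Finitely many vectors span a space that embeds isometrically in the
    Euclidean space of dimension their number, where the restricted
    invertibility of matrices applies. *)
Lemma finite_restricted_invertibility_seq (T : choiceType) (f : T -> H)
    (l : seq T) (B eps u : R) : 0 < B -> 0 < eps < 1 -> 0 < u -> uniq l ->
  (forall x, \sum_(i <- l) rabs (dot x (f i)) ^+ 2 <= B * rnorm x ^+ 2) ->
  (forall i, i \in l -> u <= rnorm (f i)) ->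
  exists l', [/\ uniq l', {subset l' <= l},
    (1 - eps) * u ^+ 2 / B * (size l)%:R <= (size l')%:R &
    forall a : T -> K, c eps * u ^+ 2 * (\sum_(i <- l') rabs (a i) ^+ 2) <=
      rnorm (\sum_(i <- l') a i *: f i) ^+ 2].
Proof.
move=> B0 eps01 u0 ul fB fu; have [_ _ _ fri] := c_fri.
case: l ul fB fu => [|x0 l0]; first by
  exists [::]; split => // [|a]; rewrite ?mulr0// !big_nil rnorm0 expr0n mulr0.
set l := x0 :: l0 => ul fB fu; pose n := size l.
pose v (i : 'I_n) := f (nth x0 l i).
have [ws szw wsP] := gram_schmidt dot_norm [seq v i | i <- enum 'I_n].
have {}szw : size ws = n by rewrite szw size_map size_enum_ord.
(* the columns are the coordinates of the vectors in the orthonormal system *)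
pose M : 'M[K]_n := \matrix_(k, i) dot (v i) (nth 0 ws k).
pose Tm : {linear 'cV[K]_n -> 'cV[K]_n} := mulmx M.
have synth (b : 'cV[K]_n) :
    l2norm (Tm b) ^+ 2 = rnorm (\sum_i b i 0 *: v i) ^+ 2.
  rewrite l2norm_sqr (frame_sum_norm dot_norm (ws := ws)); last first.
    rewrite frame_sum_lin; apply: eq_bigr => i _; congr (_ *: _).
    by apply: wsP; left; apply: map_f; rewrite mem_enum.
  rewrite [RHS](big_nth 0) szw big_mkord; apply: eq_bigr => k _.
  rewrite mxE dot_suml; congr (rabs _ ^+ 2); apply: eq_bigr => i _.
  by rewrite mxE dotZl mulrC.
pose e (i : 'I_n) : 'cV[K]_n := delta_mx i 0.
have sum_e (b : 'I_n -> K) (J : {set 'I_n}) :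
    l2norm (\sum_(j in J) b j *: Tm (e j)) ^+ 2 =
    rnorm (\sum_(j in J) b j *: v j) ^+ 2.
  have -> : \sum_(j in J) b j *: Tm (e j) = Tm (\sum_(j in J) b j *: e j).
    by rewrite linear_sum; apply: eq_bigr => j _; rewrite linearZ.
  rewrite synth; congr (rnorm _ ^+ 2); rewrite [RHS]big_mkcond.
  apply: eq_bigr => i _; rewrite summxE.
  case: (boolP (i \in J)) => iJ.
    rewrite (bigD1 i)//= big1 ?addr0 ?mxE ?eqxx ?mulr1// => j /andP[_ ji].
    by rewrite !mxE eq_sym (negPf ji) mulr0.
  rewrite big1 ?scale0r// => j jJ; rewrite !mxE.
  by case: eqP => [ij|]; rewrite ?mulr0//; rewrite ij jJ in iJ.
have e_on : orthonormal_basis e.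
  move=> i j; rewrite /l2dot (bigD1 i)//= big1 => [|k ki].
    rewrite !mxE !eqxx mul1r addr0 andbT.
    by case: eqP => _; rewrite ?sconj0// -emb1 sconj_emb.
  by rewrite !mxE (negPf ki) mul0r.
have Te i : l2norm (Tm (e i)) = rnorm (v i).
  have := sum_e (fun=> 1) (finset.set1 i); rewrite !big_set1 !scale1r => /eqP.
  by rewrite eqrXn2 ?sqrtr_ge0 ?rnorm_ge0// => /eqP.
have vB x : \sum_i rabs (dot x (v i)) ^+ 2 <= B * rnorm x ^+ 2.
  by have := fB x; rewrite (big_nth x0) big_mkord.
have T_le x : l2norm x <= 1 -> l2norm (Tm x) <= Num.sqrt B.
  move=> x1; rewrite -ler_sqr ?nnegrE ?sqrtr_ge0// (sqr_sqrtr (ltW B0)) synth.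
  apply: (le_trans (synth_bound dot_norm B0 vB (fun i => x i 0))).
  rewrite -l2norm_sqr ger_pMr// expr_le1// sqrtr_ge0//.
pose S := [set l2norm (Tm x) | x in [set x | l2norm x <= 1]].
have S_ub : ubound S (Num.sqrt B) by move=> _ [x /T_le h <-].
have Se i : S (rnorm (v i)).
  exists (e i); last exact: Te.
  rewrite /= /l2norm (bigD1 i)//= big1 => [|k ki].
    by rewrite mxE !eqxx -emb1 rabs_emb// expr1n addr0 sqrtr1.
  by rewrite mxE (negPf ki) rabs0 expr0n.
have opn_leB : opnorm Tm ^+ 2 <= B.
  rewrite -[leRHS](sqr_sqrtr (ltW B0)) ler_sqr ?nnegrE ?sqrtr_ge0//.
    by apply: ge_sup => //; exists (rnorm (v ord0)); exact: Se.
  apply: le_trans (rnorm_ge0 (v ord0)) _.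
  by apply: ub_le_sup; [exists (Num.sqrt B)|exact: Se].
have opn_gt0 : 0 < opnorm Tm.
  apply: (lt_le_trans u0); apply: (@le_trans _ _ (rnorm (v ord0))).
    by apply: fu; rewrite mem_nth.
  by apply: ub_le_sup; [exists (Num.sqrt B)|exact: Se].
have [|j|J [JC Jlow]] := fri eps n u e Tm eps01 _ u0 e_on.
- by [].
- by rewrite Te fu// mem_nth.
exists [seq nth x0 l i | i : 'I_n <- enum J]; split.
- rewrite map_inj_in_uniq ?enum_uniq// => i j _ _ /eqP.
  by rewrite nth_uniq// => /eqP/val_inj.
- by move=> _ /mapP[i _ ->]; rewrite mem_nth.
- rewrite size_map -cardE -ler_pdivlMr ?ltr0n//; apply: le_trans JC.
  apply: ler_wpM2l.
    by rewrite mulr_ge0 ?sqr_ge0//; case/andP: eps01; lra.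
  by rewrite lef_pV2 // posrE exprn_gt0.
- move=> a; have := Jlow (fun i => a (nth x0 l i)).
  by rewrite sum_e !big_map !big_enum.
Qed.
End RestrictedInvertibility.

(** * The frame operator and the dual frame *)

Section FrameOperator.
Context (R : realType) (s : scalar_kind).
Local Notation K := (scalars R s).
Context (H : completeNormedModType K) (dot : {dot H for sconj R s}).
Hypothesis dot_norm : forall x : H, `|x| ^+ 2 = dot x x.
Context (T : choiceType) (g : T -> H) (A B : R).
Hypothesis g_frame : frame_with_bounds dot g A B.
Implicit Types (x y z : H).
Local Notation S := (frame_operator dot g).

Let A0 : 0 < A. Proof. by case: g_frame. Qed.
Let B0 : 0 < B. Proof. by case: g_frame => a0 ab _ _; exact: lt_le_trans ab. Qed.
Let gB : bessel dot g B. Proof. by case: g_frame. Qed.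

Lemma cvg_sre_dot (U : Type) (F : set_system U) {FF : Filter F} (v : U -> H) x y :
  v @ F --> x -> (fun t => sre (dot (v t) y)) @ F --> sre (dot x y).
Proof.
move=> vx; have y1 : 0 < rnorm y + 1 by rewrite ltr_wpDl ?rnorm_ge0.
apply/cvgrPdist_lt => e e0; have /rcvgP/(_ (e / (rnorm y + 1))) := vx.
rewrite divr_gt0// => /(_ isT); apply: filterS => t h.
have -> : sre (dot x y) - sre (dot (v t) y) = sre (dot (x - v t) y).
  by rewrite dotBl sreD sreN.
have le_abs z : `|sre (dot z y)| <= rnorm z * rnorm y.
  apply: le_trans (cauchy_schwarz dot_norm _ _); rewrite ler_norml sre_le_rabs.
  by rewrite lerNl -sreN -rabsN sre_le_rabs.
apply: le_lt_trans (le_abs _) _; rewrite ltr_pdivlMr// in h.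
by apply: le_lt_trans h; rewrite ler_wpM2l ?rnorm_ge0// lerDl.
Qed.

Lemma frame_operator_cvg x :
  summability.partial_sum (fun i => dot x (g i) *: g i)
    @ summability.totally --> S x.
Proof.
have : cvg (summability.partial_sum (fun i => dot x (g i) *: g i)
    @ summability.totally); last by [].
apply: (synth_cvg B0); first by move=> l ul; exact: (bessel_synth dot_norm).
by apply: le_lt_trans (gB x) (ltry _).
Qed.

Lemma frame_operatorP (a : K) x y : S (a *: x + y) = a *: S x + S y.
Proof.
apply: (@cvg_unique _ (@norm_hausdorff _ H)
  (summability.partial_sum (fun i => dot (a *: x + y) (g i) *: g i)
    @ summability.totally)); first exact: frame_operator_cvg.
have -> : summability.partial_sum (fun i => dot (a *: x + y) (g i) *: g i) =
    (fun X => a *: summability.partial_sum (fun i => dot x (g i) *: g i) X +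
      summability.partial_sum (fun i => dot y (g i) *: g i) X).
  apply/funext => X; rewrite !partial_sumE scaler_sumr -big_split/=.
  by apply: eq_bigr => i _; rewrite dotDl dotZl scalerDl scalerA.
apply: cvgD; last exact: frame_operator_cvg.
by apply: cvgZr; exact: frame_operator_cvg.
Qed.

Lemma frame_operator0 : S 0 = 0.
Proof.
have := frame_operatorP 1 0 0; rewrite !scale1r addr0 => /eqP.
by rewrite -subr_eq0 opprD addNKr oppr_eq0 => /eqP.
Qed.

Lemma frame_operatorB x y : S (x - y) = S x - S y.
Proof. by rewrite addrC -scaleN1r frame_operatorP scaleN1r addrC. Qed.

Lemma frame_operator_sum (l : seq T) (a : T -> K) (y : T -> H) :
  S (\sum_(i <- l) a i *: y i) = \sum_(i <- l) a i *: S (y i).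
Proof.
elim: l => [|i l IH]; first by rewrite !big_nil frame_operator0.
by rewrite !big_cons frame_operatorP IH.
Qed.

Lemma frame_operator_ge x : A * rnorm x ^+ 2 <= sre (dot (S x) x).
Proof.
have [_ _ /(_ x) lo _] := g_frame; rewrite -lee_fin; apply: (le_trans lo).
apply: esum_le_seq => l ul _; rewrite sumEFin lee_fin.
apply: (cvgr_to_ge (cvg_sre_dot (y := x) (@frame_operator_cvg x))).
apply/totallyP; exists [fset i in l]%fset => X lX.
rewrite partial_sumE dot_suml sre_sum.
have -> : \sum_(i <- X) sre (dot (dot x (g i) *: g i) x) =
    \sum_(i <- X) rabs (dot x (g i)) ^+ 2.
  by apply: eq_bigr => i _; rewrite dotZl (dotC dot (g i)) sre_mul_sconj.
rewrite -lee_fin -!sumEFin -[leRHS](esum_seq (fset_uniq X)); last first.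
  by move=> i _; rewrite lee_fin sqr_ge0.
by apply: sum_le_esum => // i il /=; apply: (fsubsetP lX); rewrite !inE.
Qed.

Lemma frame_operator_le x : rnorm (S x) <= B * rnorm x.
Proof.
rewrite -ler_sqr ?nnegrE ?rnorm_ge0 ?mulr_ge0 ?rnorm_ge0 ?(ltW B0)//.
apply: (cvgr_to_le (cvg_rnorm_sqr (@frame_operator_cvg x))).
apply: nearW => X; rewrite partial_sumE.
apply: (le_trans (bessel_synth dot_norm _ B0 gB (fset_uniq X))).
rewrite exprMn [B ^+ 2]expr2 -mulrA ler_pM2l//.
exact: bessel_seq.
Qed.

Lemma frame_operator_lower x : rnorm x <= A^-1 * rnorm (S x).
Proof.
rewrite ler_pdivlMl//.
have [->|x0] := eqVneq (rnorm x) 0; first by rewrite mulr0 rnorm_ge0.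
have x_gt0 : 0 < rnorm x by rewrite lt_def x0 rnorm_ge0.
rewrite -(ler_pM2r x_gt0) -mulrA -expr2 (le_trans (frame_operator_ge x))//.
by apply: le_trans (sre_le_rabs _) (cauchy_schwarz dot_norm _ _).
Qed.

(** The Richardson iteration [y + t (h - S y)]: for [t = A / B^2] it
    contracts the residual [h - S y], and the lower bound on [S] turns small
    residuals into a Cauchy sequence. *)
Lemma frame_operator_surj h : exists y, S y = h.
Proof.
(* the minimizer of the bound 1 - 2 t A + t^2 B^2 on the contraction factor *)
pose t := A / B ^+ 2; pose q := 1 - A ^+ 2 / B ^+ 2.
have t0 : 0 < t by rewrite divr_gt0 ?exprn_gt0.
have q01 : 0 <= q < 1.
  rewrite /q subr_ge0 ler_pdivrMr ?exprn_gt0// mul1r ler_sqr ?nnegrE ?(ltW A0) ?(ltW B0)//.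
  have [_ -> _ _] := g_frame; rewrite /= ltrBlDr ltrDl.
  by rewrite divr_gt0 ?exprn_gt0.
have contr z : rnorm (z - emb s t *: S z) ^+ 2 <= q * rnorm z ^+ 2.
  rewrite (rnormD_sqr dot_norm) rnormN rnormZ rabs_emb ?(ltW t0)//.
  rewrite dotNr dotZr sconj_emb sreN sre_mul_emb.
  have : sre (dot z (S z)) = sre (dot (S z) z) by rewrite (dotC dot z) sre_sconj.
  move=> ->; have lo := frame_operator_ge z.
  have up : rnorm (S z) ^+ 2 <= B ^+ 2 * rnorm z ^+ 2.
    rewrite -exprMn ler_sqr ?nnegrE ?rnorm_ge0 ?mulr_ge0 ?rnorm_ge0 ?(ltW B0)//.
    exact: frame_operator_le.
  have : t * (A * rnorm z ^+ 2) <= t * sre (dot (S z) z) by rewrite ler_pM2l.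
  have : t ^+ 2 * rnorm (S z) ^+ 2 <= t ^+ 2 * (B ^+ 2 * rnorm z ^+ 2).
    by rewrite ler_wpM2l ?sqr_ge0.
  have -> : q = 1 - 2 * (t * A) + t ^+ 2 * B ^+ 2.
    by rewrite /q /t; field; rewrite gt_eqF.
  by rewrite [(t * _) ^+ 2]exprMn => h1 h2; lra.
pose F y := y + emb s t *: (h - S y); pose y n := iter n F 0.
pose e n := h - S (y n).
have eS n : e n.+1 = e n - emb s t *: S (e n).
  rewrite {1}/e (_ : y n.+1 = emb s t *: e n + y n); last exact: addrC.
  by rewrite frame_operatorP opprD [- _ - _]addrC addrA.
have e_le n : rnorm (e n) ^+ 2 <= q ^+ n * rnorm h ^+ 2.
  elim: n => [|n IH]; first by rewrite /e /= frame_operator0 subr0 mul1r.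
  rewrite eS; apply: (le_trans (contr _)); rewrite [q ^+ _]exprS -mulrA ler_wpM2l//.
  by case/andP: q01.
have e_small (d : R) : 0 < d -> \forall n \near \oo, rnorm (e n) < d.
  move=> d0.
  have /cvgrPdist_lt/(_ (d ^+ 2 / (rnorm h ^+ 2 + 1))) :
      (fun n => q ^+ n) @ \oo --> (0 : R).
    by apply: cvg_expr; case/andP: q01 => q0 q1; rewrite ger0_norm.
  have h1 : 0 < rnorm h ^+ 2 + 1 by rewrite ltr_wpDl ?sqr_ge0.
  rewrite divr_gt0 ?exprn_gt0// => /(_ isT); apply: filterS => n.
  rewrite sub0r normrN ger0_norm ?exprn_ge0//; last by case/andP: q01.
  rewrite ltr_pdivlMr// => hn.
  rewrite -ltr_sqr ?nnegrE ?rnorm_ge0 ?(ltW d0)//.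
  apply: le_lt_trans (e_le n) (le_lt_trans _ hn).
  by rewrite ler_wpM2l ?lerDl// exprn_ge0//; case/andP: q01.
have /cvg_ex[/= y' yy'] : cvg (y @ \oo).
  apply: rcauchy_cvg => d d0.
  have dA : 0 < A * d / 2 by rewrite divr_gt0// mulr_gt0.
  have [N _ hN] := e_small _ dA.
  exists (y N); exists N => // n /= /hN hn.
  apply: le_lt_trans (frame_operator_lower _) _.
  rewrite ltr_pdivrMl// frame_operatorB.
  have -> : S (y N) - S (y n) = e n - e N.
    by rewrite /e [RHS]addrC opprB addrA subrK.
  apply: le_lt_trans (rnormD _ _) _; rewrite rnormN.
  by have := hN N (leqnn N); rewrite /= in hn *; lra.
exists y'; apply/eqP; rewrite -subr_eq0 -normr_eq0 hnormE -(emb0 R s).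
apply/eqP; congr (emb s _); apply/eqP; rewrite eq_le rnorm_ge0 andbT.
apply/ler_addgt0Pr => d d0; rewrite add0r.
have d2 : 0 < d / 2 by rewrite divr_gt0.
have dB : 0 < d / 2 / B by rewrite divr_gt0.
have /rcvgP/(_ _ dB) yN := yy'.
have [n [/= en yn]] := filter_ex (filterI (e_small _ d2) yN).
have -> : S y' - h = S (y' - y n) - e n.
  by rewrite frame_operatorB /e opprB addrA subrK.
apply: le_trans (rnormD _ _) _; rewrite rnormN.
have := frame_operator_le (y' - y n).
by rewrite ltr_pdivlMr// mulrC in yn; lra.
Qed.

Lemma frame_operator_dual k : S (dual_frame dot g k) = g k.
Proof. exact: (@xgetPex _ 0 [set y | S y = g k] (frame_operator_surj (g k))). Qed.

(** Applying [S] turns these partial sums into those that define [S x], and [S]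
    is bounded below. *)
Lemma dual_expansion x :
  summability.partial_sum (fun n => dot x (g n) *: dual_frame dot g n)
    @ summability.totally --> x.
Proof.
apply/rcvgP => e e0; have Ae : 0 < A * e by rewrite mulr_gt0.
have /rcvgP/(_ _ Ae) := @frame_operator_cvg x; apply: filterS => X h.
apply: le_lt_trans (frame_operator_lower _) _.
rewrite ltr_pdivrMl// frame_operatorB !partial_sumE frame_operator_sum.
by under eq_bigr do rewrite frame_operator_dual; rewrite -partial_sumE.
Qed.

Lemma rabs_dot_cvg_le (U : Type) (F : set_system U) {FF : ProperFilter F}
    (v : U -> H) x y (C : R) : v @ F --> x ->
  (forall t, rabs (dot (v t) y) <= C) -> rabs (dot x y) <= C.
Proof.
move=> vx hC; apply/ler_addgt0Pr => e e0.
have y1 : 0 < rnorm y + 1 by rewrite ltr_wpDl ?rnorm_ge0.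
have /rcvgP/(_ (e / (rnorm y + 1))) := vx.
rewrite divr_gt0// => /(_ isT)/filter_ex[t h].
rewrite -[x](subrK (v t)) dotDl addrC; apply: le_trans (rabsD _ _) _.
apply: lerD; first exact: hC.
rewrite ltr_pdivlMr// in h; apply: le_trans (cauchy_schwarz dot_norm _ _) _.
by apply: le_trans (ltW h); rewrite ler_wpM2l ?rnorm_ge0// lerDl.
Qed.

(** Both vectors are expanded in the dual frame, one after the other. *)
Lemma dual_dot_le x y :
  ((rabs (dot x y))%:E <= \esum_(n in [set: T]) \esum_(m in [set: T])
    (rabs (dot x (g n)) * rabs (dot y (g m)) *
     rabs (dot (dual_frame dot g n) (dual_frame dot g m)))%:E)%E.
Proof.
set d := dual_frame dot g.
set C := (\esum_(_ in _) _)%E.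
have C0 : (0 <= C)%E.
  by apply: esum_ge0 => n _; apply: esum_ge0 => m _; rewrite lee_fin !mulr_ge0 ?rabs_ge0.
have [->|Coo] := eqVneq C +oo%E; first exact: leey.
have Cfin : C \is a fin_num by rewrite ge0_fin_numE// ltey.
rewrite -(fineK Cfin) lee_fin.
apply: (rabs_dot_cvg_le (@dual_expansion x)) => X.
rewrite rabs_dotC; apply: (rabs_dot_cvg_le (@dual_expansion y)) => Y.
rewrite rabs_dotC !partial_sumE -lee_fin fineK// dot_suml.
under eq_bigr do rewrite dot_sumr.
apply: (@le_trans _ _ (\sum_(n <- X) \sum_(m <- Y)
   (rabs (dot x (g n)) * rabs (dot y (g m)) * rabs (dot (d n) (d m)))%:E)%E).
  under [leRHS]eq_bigr do rewrite sumEFin.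
  rewrite sumEFin lee_fin; apply: (le_trans (rabs_sum _ _ _)).
  apply: ler_sum => n _; apply: (le_trans (rabs_sum _ _ _)).
  by apply: ler_sum => m _; rewrite dotZl dotZr !rabsM rabs_sconj mulrA.
apply: (@le_trans _ _ (\sum_(n <- X) \esum_(m in [set: T])
   (rabs (dot x (g n)) * rabs (dot y (g m)) * rabs (dot (d n) (d m)))%:E)%E).
  by apply: lee_sum => n _; apply: sum_le_esum; rewrite ?fset_uniq.
by apply: sum_le_esum; rewrite ?fset_uniq.
Qed.

End FrameOperator.

(** * Balls and tiles in the index group *)

Section Geometry.
Context (R : realType) (d1 d2 : nat) (N : 'I_d2 -> nat).
Local Notation G := (index_group d1 N).
Implicit Types (x y k : G) (m w : nat).

(** The cyclic coordinates are bounded, so only the free ones matter for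
    the large-scale geometry; unlike [sup_dist], this gauge is translation
    invariant. *)
Definition gauge x : nat := \max_(j < d1) `|x.1 j|%N.

Definition gauge_ball m k : set G := [set x | (gauge (x - k) <= m)%N].

Lemma gauge_leP x m :
  reflect (forall j, (`|x.1 j| <= m)%N) (gauge x <= m)%N.
Proof. by apply: (iffP (bigmax_leqP _ _ _)) => h j *; exact: h. Qed.

Lemma fstB x y j : (x - y).1 j = x.1 j - y.1 j.
Proof. by rewrite !ffunE. Qed.

Lemma gaugeN x : gauge (- x) = gauge x.
Proof. by apply: eq_bigr => j _; rewrite !ffunE abszN. Qed.

Lemma gaugeB x y : gauge (x - y) = gauge (y - x).
Proof. by rewrite -gaugeN opprB. Qed.

Lemma gaugeD x y : (gauge (x + y) <= gauge x + gauge y)%N.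
Proof.
have abszD (a b : int) : (`|(a + b)%R| <= `|a| + `|b|)%N by lia.
apply/gauge_leP => j; rewrite !ffunE; apply: leq_trans (abszD _ _) _.
by apply: leq_add; move: j; apply/gauge_leP.
Qed.

Lemma gauge_triangle x y k : (gauge (x - k) <= gauge (x - y) + gauge (y - k))%N.
Proof. by rewrite -{1}(subrK y x) -addrA gaugeD. Qed.

Lemma sup_dist_leE x y m : (\max_(j < d2) N j <= m)%N ->
  (sup_dist x y <= m)%N = (gauge (x - y) <= m)%N.
Proof.
move=> Nm; rewrite /sup_dist geq_max.
have -> : (\max_(j < d1) `|x.1 j - y.1 j|)%N = gauge (x - y).
  by apply: eq_bigr => j _; rewrite fstB.
have [_|//] := leqP (gauge (x - y)) m; rewrite andTb.
apply/bigmax_leqP => j _.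
have Nj : (N j <= m)%N by apply: leq_trans Nm; exact: leq_bigmax.
have : ((x.2 j : nat) < (N j).-1.+1)%N by exact: ltn_ord.
have : ((y.2 j : nat) < (N j).-1.+1)%N by exact: ltn_ord.
by move: (nat_of_ord (x.2 j)) (nat_of_ord (y.2 j)) => a b; lia.
Qed.

Lemma gballE (r : R) k : (\max_(j < d2) N j)%:R <= r ->
  gball r k = gauge_ball (Num.truncn r) k.
Proof.
move=> Nr; have r0 : 0 <= r by apply: le_trans Nr.
have Nt : (\max_(j < d2) N j <= Num.truncn r)%N by rewrite truncn_ge_nat.
apply/seteqP; split => x; rewrite /gball /gauge_ball /= -truncn_ge_nat// => h.
  by rewrite -sup_dist_leE.
by rewrite sup_dist_leE.
Qed.

Definition volume m : nat := ((m.*2.+1) ^ d1 * #|{: {dffun forall j : 'I_d2, 'I_(N j).-1.+1}}|)%N.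

Lemma volume_gt0 m : (0 < volume m)%N.
Proof. by rewrite muln_gt0 expn_gt0 /=; apply/card_gt0P; exists (cyclics_zero N). Qed.

Lemma gauge_ball_card m k :
  (\esum_(x in gauge_ball m k) 1 = (volume m)%:R%:E :> \bar R)%E.
Proof.
(* a finite type in bijection with the ball, by translation *)
pose Q := ({ffun 'I_d1 -> 'I_(m.*2.+1)} * {dffun forall j : 'I_d2, 'I_(N j).-1.+1})%type.
pose e (p : Q) : G := ([ffun j => k.1 j + ((p.1 j)%:Z - m%:Z)], p.2).
rewrite (reindex_esum [set: Q] _ e); last first.
  split.
  - move=> [p q] _ /=; apply/gauge_leP => j.
    rewrite fstB !ffunE /= addrC addKr; have : (nat_of_ord (p j) < m.*2.+1)%N := ltn_ord _.
    by move: (nat_of_ord (p j)) => a; lia.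
  - move=> [p q] [p' q'] _ _ [/ffunP h ->]; congr pair.
    apply/ffunP => j; have := h j; rewrite !ffunE => /addrI/addIr[].
    exact: val_inj.
  - move=> [y q] /= /gauge_leP h.
    have shift (a b : int) : (absz (a - b)%R <= m)%N ->
        (absz (a - b + m%:Z)%R < m.*2.+1)%N /\
        b + ((absz (a - b + m%:Z)%R)%:Z - m%:Z) = a by lia.
    exists ([ffun j => inord (absz (y j - k.1 j + m%:Z)%R)], q) => //.
    congr pair; apply/ffunP => j; rewrite !ffunE /=.
    have := h j; rewrite fstB /= => /shift[lt_m eq_m].
    by rewrite inordK.
rewrite esum_finType// sumEFin sumr_const card_prod card_ffun !card_ord.
by [].
Qed.

(** The ratio of the volumes is a fixed power of [1 + t] with
    [t = 2 c / (2 m + 1)], and (1 + t)^d <= 1 + (2^d - 1) t by convexity. *)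
Lemma volume_shell c (eta : R) : 0 < eta ->
  exists m0, forall m, (m0 <= m)%N ->
    (volume (m + c))%:R <= (1 + eta) * (volume m)%:R.
Proof.
move=> eta0.
have pow_le d (t : R) : 0 <= t <= 1 -> (1 + t) ^+ d <= 1 + (2 ^+ d - 1) * t.
  move=> /andP[t0 t1]; elim: d => [|d IH]; first by rewrite !expr0; lra.
  rewrite exprS; apply: (@le_trans _ _ ((1 + t) * (1 + (2 ^+ d - 1) * t))).
    by rewrite ler_wpM2l//; lra.
  have p1 : 1 <= 2 ^+ d :> R by rewrite exprn_ege1// ler1n.
  rewrite [2 ^+ d.+1]exprS; set p := 2 ^+ d in p1 *.
  have : 0 <= (p - 1) * (t * (1 - t)) by rewrite !mulr_ge0//; lra.
  nra.
pose M : R := 2 ^+ d1 * (2 * c%:R).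
have M0 : 0 <= M by rewrite !mulr_ge0 ?exprn_ge0.
exists (maxn c (Num.truncn (M / eta)).+1) => m; rewrite geq_max => /andP[cm Mm].
pose t : R := (2 * c%:R) / (m.*2.+1)%:R.
have m0 : 0 < (m.*2.+1)%:R :> R by rewrite ltr0n.
have t01 : 0 <= t <= 1.
  rewrite /t divr_ge0 ?mulr_ge0//= ler_pdivrMr// mul1r -natrM ler_nat.
  lia.
have tE : ((m + c).*2.+1)%:R = (1 + t) * (m.*2.+1)%:R.
  rewrite /t mulrDl mul1r mulfVK ?gt_eqF// -natrM -natrD; congr _%:R; lia.
rewrite /volume !natrM !natrX mulrA tE exprMn ler_wpM2r// ler_wpM2r ?exprn_ge0//.
apply: le_trans (pow_le _ _ t01) _; rewrite lerD2l.
apply: (@le_trans _ _ (2 ^+ d1 * t)).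
  by rewrite ler_wpM2r//; [case/andP: t01|rewrite gerBl].
rewrite /t mulrA ler_pdivrMr// -/M -ler_pdivrMl// mulrC.
apply: le_trans (ltW (truncnS_gt _)) _; rewrite ler_nat.
apply: leq_trans Mm _; lia.
Qed.

Section Tiles.
Variable w : nat.
Local Notation P := (w.*2.+1).

(** The cubes of side [2 w + 1] centred on the sublattice of multiples of
    their side partition the group; they are labelled by the free part. *)
Definition tile x : {ffun 'I_d1 -> int} := [ffun j => ((x.1 j + w%:Z) %/ P%:Z)%Z].

Definition tile_center (p : {ffun 'I_d1 -> int}) : G := ([ffun j => p j * P%:Z], 0).

Lemma divz_centered (a p : int) :
  ((a + w%:Z) %/ P%:Z)%Z = p <-> (absz (a - p * P%:Z)%R <= w)%N.
Proof.
have := divz_eq (a + w%:Z) P%:Z.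
have := @modz_ge0 (a + w%:Z) P%:Z isT.
have := @ltz_pmod (a + w%:Z) P%:Z isT.
set q := (_ %/ _)%Z; set r := (_ %% _)%Z.
have PE : P%:Z = 2 * w%:Z + 1 by lia.
move: (P%:Z) PE q r => Q PE q r r_lt r_ge aE.
have aq : a - q * Q = r - w%:Z by rewrite -[a](addrK w%:Z) aE; lia.
split=> [<-|ap]; first by rewrite aq; lia.
have pq : (p - q) * Q = (a - q * Q) - (a - p * Q) by rewrite mulrBl; lia.
have [h|h|//] := ltrgtP q p; exfalso.
  have : Q <= (p - q) * Q by rewrite ler_peMl; lia.
  lia.
have : Q <= (q - p) * Q by rewrite ler_peMl; lia.
have : (q - p) * Q = - ((p - q) * Q) by rewrite -mulNr opprB.
lia.
Qed.

Lemma tileP x p : (tile x == p) = (gauge (x - tile_center p) <= w)%N.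
Proof.
apply/eqP/gauge_leP => [<- j|h].
  by rewrite fstB /= !ffunE; apply/divz_centered.
apply/ffunP => j; have := h j; rewrite fstB /= !ffunE => hj.
by apply/divz_centered.
Qed.

Lemma tile_card p : (\esum_(x in [set x | tile x == p]) 1 = (volume w)%:R%:E :> \bar R)%E.
Proof.
rewrite -(gauge_ball_card _ (tile_center p)); congr (esum _ _).
by apply/seteqP; split => x /=; rewrite tileP.
Qed.

Lemma tile_diam x y : tile x = tile y -> (gauge (x - y) <= w.*2)%N.
Proof.
move=> /eqP; rewrite tileP => hx; have := eqxx (tile y); rewrite tileP => hy.
rewrite -addnn; apply: leq_trans (gauge_triangle x (tile_center (tile y)) y) _.
by rewrite leq_add// gaugeB.
Qed.

(** A point of depth [L] in its tile is more than [L] away from all other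
    tiles. *)
Lemma tile_separation L x y : (L <= w)%N ->
  (gauge (x - tile_center (tile x)) <= w - L)%N -> tile x != tile y ->
  (L < gauge (x - y))%N.
Proof.
move=> Lw hx; apply: contraNT; rewrite -leqNgt => xy.
rewrite eq_sym tileP; apply: leq_trans (gauge_triangle y x _) _.
rewrite gaugeB; lia.
Qed.

End Tiles.

End Geometry.

(** * Counting localized elements *)

Section Counting.
Context (R : realType) (d1 d2 : nat) (N : 'I_d2 -> nat).
Local Notation G := (index_group d1 N).
Implicit Types (x y k : G) (m w L : nat) (theta : G -> R).

Lemma esum_translate (phi : G -> \bar R) k :
  (\esum_(x in [set: G]) phi (x - k)%R = \esum_(x in [set: G]) phi x)%E.
Proof.
rewrite [RHS](esum_bij (e := fun x => x - k))//.
by exists (fun x => x + k) => x; rewrite ?subrK ?addrK.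
Qed.

Lemma esum_reflect (phi : G -> \bar R) k :
  (\esum_(x in [set: G]) phi (k - x)%R = \esum_(x in [set: G]) phi x)%E.
Proof.
rewrite [RHS](esum_bij (e := fun x => k - x))//.
by exists (fun x => k - x) => x; rewrite subKr.
Qed.

Lemma gauge_tail theta (eta : R) : (forall x, 0 <= theta x) ->
  (\esum_(x in [set: G]) (theta x)%:E < +oo)%E -> 0 < eta ->
  exists L, (\esum_(x in [set x | (L < gauge x)%N]) (theta x)%:E <= eta%:E)%E.
Proof.
move=> theta0 thetaoo eta0.
have theta0' x : (0 <= (theta x)%:E)%E by rewrite lee_fin.
have [l hl] := esum_tail theta0' thetaoo eta0.
exists (\max_(x <- l) gauge x)%N; apply: le_trans hl.
apply: subset_esum => // x /= lx xl.
by move: lx; rewrite ltnNge leq_bigmax_seq.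
Qed.

Section Multiplicity.
Context (T : choiceType) (kappa : T -> G) (M : R).
Hypothesis M0 : 0 <= M.
Hypothesis mult : forall k, (\esum_(i in [set i | kappa i == k]) 1 <= M%:E)%E.

Definition count_in m k : \bar R :=
  (\esum_(i in [set i | (gauge (kappa i - k) <= m)%N]) 1)%E.

(** Each point of the group is hit at most [M] times. *)
Lemma esum_kappa_le theta : (forall x, 0 <= theta x) ->
  (\esum_(i in [set: T]) (theta (kappa i))%:E <=
    M%:E * \esum_(x in [set: G]) (theta x)%:E)%E.
Proof.
move=> theta0.
have theta0' x : (0 <= (theta x)%:E)%E by rewrite lee_fin.
have -> : (\esum_(i in [set: T]) (theta (kappa i))%:E =
    \esum_(i in [set: T]) \esum_(x in [set: G])
      (if kappa i == x then (theta x)%:E else 0))%E.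
  apply: eq_esum => i _; rewrite (esum_if (fun x => kappa i == x)).
  have -> : [set x | kappa i == x] = [set kappa i].
    by apply/seteqP; split => x /=; [move/eqP|move->].
  by rewrite esum_set1.
rewrite exchange_esum => [|i x]; last by case: ifP.
rewrite -esumZl//; apply: le_esum => x _.
rewrite (esum_if (fun i => kappa i == x)).
under eq_esum do rewrite -[(theta x)%:E]mule1.
by rewrite esumZl// muleC lee_wpmul2r.
Qed.

Lemma count_in_le m k : (count_in m k <= (M * (volume d1 N m)%:R)%:E)%E.
Proof.
pose theta x : R := if (gauge (x - k) <= m)%N then 1 else 0.
have theta0 x : 0 <= theta x by rewrite /theta; case: ifP.
have := esum_kappa_le theta0.
have fE (U : choiceType) (h : U -> G) :
    (\esum_(i in [set: U]) (theta (h i))%:E =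
     \esum_(i in [set i | (gauge (h i - k) <= m)%N]) 1)%E.
  rewrite -(esum_if (fun i => (gauge (h i - k) <= m)%N)).
  by apply: eq_esum => i _; rewrite /theta; case: ifP.
rewrite (fE _ kappa) (fE _ id) -[in leLHS]/(count_in m k).
by rewrite gauge_ball_card EFinM.
Qed.

Lemma count_inE m k : count_in m k = (fine (count_in m k))%:E.
Proof.
rewrite fineK// ge0_fin_numE; last exact: esum_ge0.
exact: le_lt_trans (count_in_le m k) (ltry _).
Qed.

Section Mass.
Context (a : T -> G -> \bar R) (theta : G -> R).
Hypothesis a0 : forall i n, (0 <= a i n)%E.
Hypothesis a1 : forall i, (\esum_(n in [set: G]) a i n = 1)%E.
Hypothesis theta0 : forall x, 0 <= theta x.
Hypothesis thetaoo : (\esum_(x in [set: G]) (theta x)%:E < +oo)%E.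
Hypothesis a_le : forall i n, (a i n <= (theta (n - kappa i)%R)%:E)%E.

Definition mass_in m k : \bar R :=
  (\esum_(i in [set: T]) \esum_(n in gauge_ball m k) a i n)%E.

(** Elements localized in the larger ball contribute at most one each; the
    others reach the ball only with the tail of [theta]. *)
Lemma mass_in_le L m k (eta : R) :
  (\esum_(x in [set x | (L < gauge x)%N]) (theta x)%:E <= eta%:E)%E ->
  (mass_in m k <=
    count_in (m + L)%N k + ((volume d1 N m)%:R * (M * eta))%:E)%E.
Proof.
move=> tail; have inner0 i : (0 <= \esum_(n in gauge_ball m k) a i n)%E.
  exact: esum_ge0.
rewrite /mass_in (esumID [set i | (gauge (kappa i - k) <= m + L)%N])// !setTI.
apply: leeD.
  by apply: le_esum => i _; rewrite -(a1 i); apply: subset_esum.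
(* the tail of theta, as a function on the whole group *)
pose phi x : R := if (L < gauge x)%N then theta x else 0.
have phi0 x : 0 <= phi x by rewrite /phi; case: ifP.
have phi0' x : (0 <= (phi x)%:E)%E by rewrite lee_fin.
have phiE : (\esum_(x in [set: G]) (phi x)%:E <= eta%:E)%E.
  apply: le_trans tail; rewrite -(esum_if (fun x => L < gauge x)%N).
  by apply: le_esum => x _; rewrite /phi; case: ifP.
apply: (@le_trans _ _ (\esum_(i in [set: T]) \esum_(n in gauge_ball m k)
    (phi (n - kappa i)%R)%:E)%E).
  apply: (@le_trans _ _ (\esum_(i in ~` [set i | (gauge (kappa i - k) <= m + L)%N])
     \esum_(n in gauge_ball m k) (phi (n - kappa i)%R)%:E)%E); last first.
    by apply: subset_esum => // i _; exact: esum_ge0.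
  apply: le_esum => i /= /negP; rewrite -ltnNge => ki.
  apply: le_esum => n; rewrite /gauge_ball /= => nk.
  apply: le_trans (a_le i n) _.
  rewrite /phi ifT//; have := gauge_triangle (kappa i) n k.
  rewrite (gaugeB n (kappa i)) => tri.
  have := leq_trans ki (leq_trans tri (leq_add (leqnn _) nk)).
  by rewrite addnC ltn_add2r.
rewrite exchange_esum//.
apply: (@le_trans _ _ (\esum_(n in gauge_ball m k) ((M * eta)%:E * 1))%E).
  apply: le_esum => n _; rewrite mule1.
  apply: le_trans (esum_kappa_le (theta := fun x => phi (n - x)%R) _) _ => //.
  rewrite (esum_reflect (fun x => (phi x)%:E)) EFinM.
  exact: lee_wpmul2l.
have eta0 : 0 <= eta.
  by rewrite -lee_fin; apply: le_trans tail; apply: esum_ge0 => x _; rewrite lee_fin.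
by rewrite esumZl ?mulr_ge0// gauge_ball_card muleC.
Qed.

(** An element localized in the smaller ball keeps all but [eta] of its mass
    in the larger one. *)
Lemma mass_in_ge L m k (eta : R) : eta <= 1 ->
  (\esum_(x in [set x | (L < gauge x)%N]) (theta x)%:E <= eta%:E)%E ->
  ((1 - eta)%:E * count_in m k <= mass_in (m + L)%N k)%E.
Proof.
move=> eta1 tail; rewrite -esumZl ?subr_ge0//.
rewrite /mass_in.
apply: (@le_trans _ _ (\esum_(i in [set i | (gauge (kappa i - k) <= m)%N])
  \esum_(n in gauge_ball (m + L)%N k) a i n)%E); last first.
  by apply: subset_esum => // i _; exact: esum_ge0.
apply: le_esum => i /= ik; rewrite mule1.
apply: (@le_trans _ _ (\esum_(n in [set n | (gauge (n - kappa i) <= L)%N]) a i n)%E);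
  last first.
  apply: subset_esum => // n /= nL; rewrite /gauge_ball /= addnC.
  exact: leq_trans (gauge_triangle _ (kappa i) _) (leq_add _ _).
have := esumID [set n | (gauge (n - kappa i) <= L)%N] setT (a i) (fun n _ => a0 i n).
rewrite !setTI a1 => /esym.
have : (\esum_(n in ~` [set n | (gauge (n - kappa i) <= L)%N]) a i n <= eta%:E)%E.
  apply: le_trans tail.
  rewrite -(esum_if (fun x => L < gauge x)%N) -(esum_translate _ (kappa i)).
  rewrite (esum_if (fun x => L < gauge (x - kappa i))%N (fun x => (theta (x - kappa i)%R)%:E)).
  have -> : ~` [set n | (gauge (n - kappa i) <= L)%N] =
    [set n | (L < gauge (n - kappa i))%N].
    by apply/seteqP; split => n /=; rewrite ltnNge => /negP.
  by apply: le_esum => n _; exact: a_le.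
have out0 : (0 <= \esum_(n in ~` [set n | (gauge (n - kappa i) <= L)%N]) a i n)%E.
  exact: esum_ge0.
have in0 : (0 <= \esum_(n in [set n | (gauge (n - kappa i) <= L)%N]) a i n)%E.
  exact: esum_ge0.
move: out0 in0; case: (esum _ _) => [p||]//; case: (esum _ _) => [q||]// _ _.
by rewrite -EFinD !lee_fin => h [] e; lra.
Qed.

(** Passing from mass to localization points, and then to balls smaller by a
    constant, only costs boundary terms; the gap between [lambda] and one pays
    for them. *)
Lemma count_of_lower_mass (D lambda : R) c : 0 < D -> 0 < lambda < 1 ->
  (forall eta : R, 0 < eta -> exists m0, forall m k, (m0 <= m)%N ->
    (((D - eta) * (volume d1 N m)%:R)%:E <= mass_in m k)%E) ->
  exists w0, forall w k, (w0 <= w)%N ->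
    ((lambda * D * (volume d1 N w)%:R)%:E <= count_in (w - c)%N k)%E.
Proof.
(* three losses of relative size sigma: in the mass, from the tail of theta,
   and from the shell between the balls *)
move=> D0 /andP[l0 l1] hD; pose sigma := (1 - lambda) / 3.
have s0 : 0 < sigma by rewrite /sigma; lra.
have M1 : 0 < M + 1 by rewrite ltr_wpDl.
have sD0 : 0 < sigma * D by rewrite mulr_gt0.
have [m0 hm0] := hD _ sD0.
have [L hL] := gauge_tail theta0 thetaoo (divr_gt0 sD0 M1).
have [m1 hm1] := volume_shell d1 N (L + c) s0.
exists (maxn m0 m1 + L + c)%N => w k hw.
have [m mE] : exists m, m = (w - c - L)%N by eexists.
have wE : (w - c = m + L)%N by lia.
have wE2 : w = (m + (L + c))%N by lia.
have := hm0 m k; have := hm1 m; rewrite -wE2 wE => h1 h2.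
have {}h1 := h1 _; have {}h2 := h2 _.
have {}h1 : (volume d1 N w)%:R <= (1 + sigma) * (volume d1 N m)%:R.
  by apply: h1; lia.
have {}h2 : (((D - sigma * D) * (volume d1 N m)%:R)%:E <= mass_in m k)%E.
  by apply: h2; lia.
have := le_trans h2 (mass_in_le m k hL).
have v0 : 0 < (volume d1 N m)%:R :> R by rewrite ltr0n volume_gt0.
have eta_le : M * (sigma * D / (M + 1)) <= sigma * D.
  by rewrite mulrA ler_pdivrMr// [M * _]mulrC (ler_wpM2l (ltW sD0))// lerDl.
rewrite (count_inE (m + L)%N) -EFinD !lee_fin => hq.
set v := (volume d1 N m)%:R in v0 h1 hq.
have : v * (M * (sigma * D / (M + 1))) <= v * (sigma * D) by rewrite ler_pM2l.
have -> : lambda = 1 - 3 * sigma by rewrite /sigma; field.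
have lD : 0 <= (1 - 3 * sigma) * D.
  by rewrite mulr_ge0 ?(ltW D0)// /sigma; lra.
have := ler_wpM2l lD h1.
have := ltW (mulr_gt0 (mulr_gt0 s0 s0) (mulr_gt0 D0 v0)).
move=> h3 h4 h5.
apply: (le_trans h4); nra.
Qed.

Section Tiled.
Context (w K : nat).
Hypothesis tile_count : forall p,
  (\esum_(i in [set i | tile w (kappa i) == p]) 1 = K%:R%:E :> \bar R)%E.

(** Double counting of the pairs formed by an element and a group point in the
    same tile: as all tiles contain equally many elements and equally many
    points, it converts counts of elements into volumes. *)
Let pair_sumP (P : pred T) :
  (\esum_(i in [set: T]) \esum_(x in [set: G])
    (if P i && (tile w x == tile w (kappa i)) then 1 else 0) =
   (volume d1 N w)%:R%:E * \esum_(i in [set i | P i]) 1 :> \bar R)%E.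
Proof.
rewrite -esumZl// -esum_if; apply: eq_esum => i _; case: ifP => _ /=.
  by rewrite mule1 esum_if tile_card.
by rewrite esum1.
Qed.

Let pair_sumQ (Q : pred G) :
  (\esum_(i in [set: T]) \esum_(x in [set: G])
    (if Q x && (tile w x == tile w (kappa i)) then 1 else 0) =
   K%:R%:E * \esum_(x in [set x | Q x]) 1 :> \bar R)%E.
Proof.
rewrite exchange_esum => [|i x]; last by case: ifP.
rewrite -esumZl// -esum_if; apply: eq_esum => x _; case: ifP => _ /=.
  rewrite mule1 -(tile_count (tile w x)) -esum_if.
  by apply: eq_esum => i _; rewrite eq_sym.
by rewrite esum1.
Qed.

Let indic_le (b1 b2 : bool) : (b1 -> b2) ->
  ((if b1 then 1 else 0) <= (if b2 then 1 else 0) :> \bar R)%E.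
Proof. by case: b1 => [->|]//; case: b2. Qed.

Lemma tiled_count_le m k :
  ((volume d1 N w)%:R%:E * count_in m k <=
   K%:R%:E * (volume d1 N (m + w.*2)%N)%:R%:E)%E.
Proof.
rewrite -(gauge_ball_card R (m + w.*2)%N k) -pair_sumP -pair_sumQ.
apply: le_esum => i _; apply: le_esum => x _; apply: indic_le.
move=> /andP[ik /eqP xi]; rewrite xi eqxx andbT.
by apply: leq_trans (gauge_triangle x (kappa i) k) _; rewrite addnC leq_add// tile_diam.
Qed.

Lemma tiled_count_ge m k :
  (K%:R%:E * (volume d1 N m)%:R%:E <=
   (volume d1 N w)%:R%:E * count_in (m + w.*2)%N k)%E.
Proof.
rewrite -(gauge_ball_card R m k) -pair_sumP -pair_sumQ.
apply: le_esum => i _; apply: le_esum => x _; apply: indic_le.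
move=> /andP[xk /eqP xi]; rewrite xi eqxx andbT.
apply: leq_trans (gauge_triangle (kappa i) x k) _; rewrite addnC leq_add//.
by rewrite tile_diam.
Qed.

(** All errors come from shells around balls and from the tail of [theta]; they
    are made proportional to [t], and [C] collects the factors. *)
Lemma tiled_mass (eta : R) : 0 < eta -> exists m0, forall m k, (m0 <= m)%N ->
  let D := K%:R / (volume d1 N w)%:R : R in
  (((D - eta) * (volume d1 N m)%:R)%:E <= mass_in m k <=
   ((D + eta) * (volume d1 N m)%:R)%:E)%E.
Proof.
move=> eta0; set D := K%:R / _.
have vw0 : 0 < (volume d1 N w)%:R :> R by rewrite ltr0n volume_gt0.
have D0 : 0 <= D by rewrite divr_ge0 ?(ltW vw0).
pose C := D + M + 1; have C0 : 0 < C by rewrite /C ltr_wpDl ?addr_ge0.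
pose t := Num.min 1 (eta / (2 * C)).
have t0 : 0 < t by rewrite lt_min ltr01 divr_gt0 ?mulr_gt0.
have t1 : t <= 1 by rewrite ge_min lexx.
have tC : t * C <= eta / 2.
  have : t <= eta / (2 * C) by rewrite ge_min lexx orbT.
  by rewrite -(ler_pM2r C0) invfM mulrA mulfVK ?gt_eqF.
have [L hL] := gauge_tail theta0 thetaoo t0.
have [m1 hm1] := volume_shell d1 N (L + w.*2) t0.
exists (m1 + L + w.*2)%N => m k hm /=.
have KE : K%:R = D * (volume d1 N w)%:R :> R by rewrite mulfVK ?gt_eqF.
set vm := (volume d1 N m)%:R.
have vm0 : 0 < vm by rewrite ltr0n volume_gt0.
apply/andP; split; last first.
  apply: le_trans (mass_in_le m k hL) _.
  have := tiled_count_le (m + L)%N k.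
  have := hm1 m; rewrite addnA => /(_ ltac:(lia)).
  rewrite (count_inE (m + L)%N) -!EFinM -EFinD !lee_fin KE => h1.
  set q := fine _.
  rewrite [D * _]mulrC -mulrA ler_pM2l// => h2.
  have h3 := ler_wpM2l D0 h1; rewrite -/vm in h3 *.
  have : t * C * vm <= eta / 2 * vm by rewrite ler_pM2r.
  rewrite /C; have : 0 <= eta * vm by apply: ltW; rewrite mulr_gt0.
  have : 0 <= t * vm by apply: ltW; rewrite mulr_gt0.
  nra.
pose m' := (m - L - w.*2)%N.
have mE : m = (m' + w.*2 + L)%N by rewrite /m'; lia.
have := mass_in_ge (m' + w.*2)%N k t1 hL; rewrite -mE; apply: le_trans.
have := tiled_count_ge m' k.
have := hm1 m' ltac:(rewrite /m'; lia).
rewrite (_ : (m' + (L + w.*2))%N = m); last by rewrite /m'; lia.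
rewrite -/vm (count_inE (m' + w.*2)%N) -!EFinM !lee_fin KE; set q := fine _.
set vm' := (volume d1 N m')%:R => h1.
rewrite [D * _]mulrC -mulrA ler_pM2l// => h2.
have vm'0 : 0 < vm' by rewrite ltr0n volume_gt0.
have tt : 0 <= 1 - t by lra.
have h3 := ler_wpM2l tt h1.
have h4 : (1 - t) * ((1 + t) * vm') <= vm'.
  have := ltW (mulr_gt0 (mulr_gt0 t0 t0) vm'0).
  lra.
have h5 := ler_wpM2l (mulr_ge0 tt D0) (le_trans h3 h4).
have h6 := ler_wpM2l tt h2.
have h7 : t * C * vm <= eta / 2 * vm by rewrite ler_pM2r.
have h8 : 0 <= t * t * (D * vm) by rewrite !mulr_ge0 ?(ltW t0) ?(ltW vm0).
have h9 : 0 <= t * (M + 1) * vm by apply: ltW; do ?apply: mulr_gt0 => //; rewrite ltr_wpDl.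
by rewrite /C in h7; nra.
Qed.

End Tiled.
End Mass.
End Multiplicity.
End Counting.

(** * Densities as averaged masses *)

Section Densities.
Context (R : realType) (s : scalar_kind).
Local Notation K := (scalars R s).
Context (H : completeNormedModType K) (dot : {dot H for sconj R s}).
Context (d1 d2 : nat) (N : 'I_d2 -> nat).
Local Notation G := (index_group d1 N).
Context (T : choiceType) (f : T -> H) (g : G -> H).
Local Notation vol m := ((volume d1 N m)%:R : R).

(** The share of element [i] at the point [n], with total one over the group;
    densities average these shares. *)
Definition coef_mass (i : T) (n : G) : \bar R :=
  ((l2_mass dot (f i) g)^-1 * (rabs (dot (f i) (g n)) ^+ 2)%:E)%E.

Lemma volR_gt0 m : 0 < vol m.
Proof. by rewrite ltr0n volume_gt0. Qed.

Hypothesis mass_gt0 : forall i, exists2 m : R, 0 < m & l2_mass dot (f i) g = m%:E.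

Lemma coef_massE i : exists2 m : R, 0 < m & l2_mass dot (f i) g = m%:E /\
  forall n, (coef_mass i n = (m^-1)%:E * (rabs (dot (f i) (g n)) ^+ 2)%:E)%E.
Proof.
have [m m0 mE] := mass_gt0 i; exists m => //; split => // n.
by rewrite /coef_mass mE inver gt_eqF.
Qed.

Lemma coef_mass_ge0 i n : (0 <= coef_mass i n)%E.
Proof.
have [m m0 [_ ->]] := coef_massE i.
by rewrite mule_ge0// lee_fin ?sqr_ge0// invr_ge0 ltW.
Qed.

Lemma coef_mass_sum i : (\esum_(n in [set: G]) coef_mass i n = 1)%E.
Proof.
have [m m0 [mE aE]] := coef_massE i.
under eq_esum do rewrite aE.
rewrite esumZl ?invr_ge0 ?(ltW m0)//; last by move=> n _; rewrite lee_fin sqr_ge0.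
by rewrite -[X in (_ * X)%E]/(l2_mass dot (f i) g) mE -EFinM mulVf ?gt_eqF.
Qed.

Lemma ball_averageE (r : R) k : (\max_(j < d2) N j)%:R <= r ->
  ball_average dot f g r k =
    (mass_in coef_mass (Num.truncn r) k * ((vol (Num.truncn r))^-1)%:E)%E.
Proof.
move=> Nr; rewrite /ball_average /gball_card !gballE// gauge_ball_card inver.
rewrite gt_eqF ?volR_gt0//; congr (_ * _)%E.
apply: eq_esum => i _.
have [m m0 [mE aE]] := coef_massE i.
rewrite mE inver gt_eqF// -esumZl ?invr_ge0 ?(ltW m0)//; last first.
  by move=> n _; rewrite lee_fin sqr_ge0.
by apply: eq_esum => n _; rewrite aE.
Qed.

Lemma lower_density_mass (D : R) : (D%:E < lower_density dot f g)%E ->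
  exists m0, forall m k, (m0 <= m)%N ->
    ((D * vol m)%:E <= mass_in coef_mass m k)%E.
Proof.
rewrite /lower_density limf_einfE => /ereal_sup_gt[_ [V [r0 [_ r0V]] <-]] DV.
exists (maxn (\max_(j < d2) N j) (Num.truncn r0).+1) => m k.
rewrite geq_max => /andP[Nm rm].
have Vm : V m%:R.
  by apply: r0V; apply: lt_le_trans (truncnS_gt r0) _; rewrite ler_nat.
have : (D%:E <= ball_average dot f g m%:R k)%E.
  apply: le_trans (ltW DV) _; apply: (@le_trans _ _
    (ereal_inf (range (ball_average dot f g m%:R)))).
    by apply: ereal_inf_lbound; exists m%:R.
  by apply: ereal_inf_lbound; exists k.
by rewrite ball_averageE ?ler_nat// natrK lee_pdivlMr ?volR_gt0.
Qed.

Lemma upper_density_mass : (upper_density dot f g < +oo)%E ->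
  exists C : R, exists m0, forall m k, (m0 <= m)%N ->
    (mass_in coef_mass m k <= (C * vol m)%:E)%E.
Proof.
rewrite /upper_density limf_esupE => /ereal_inf_lt[_ [V [r0 [_ r0V]] <-]] Voo.
pose C := fine (ereal_sup [set ereal_sup (range (ball_average dot f g x)) | x in V]).
have CE : (ereal_sup [set ereal_sup (range (ball_average dot f g x)) | x in V]
    <= C%:E)%E.
  rewrite /C; move: Voo; case: (ereal_sup _) => [q||]//=.
  by rewrite leNye.
exists C, (maxn (\max_(j < d2) N j) (Num.truncn r0).+1) => m k.
rewrite geq_max => /andP[Nm rm].
have Vm : V m%:R.
  by apply: r0V; apply: lt_le_trans (truncnS_gt r0) _; rewrite ler_nat.
have : (ball_average dot f g m%:R k <= C%:E)%E.
  apply: le_trans CE; apply: (@le_trans _ _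
    (ereal_sup (range (ball_average dot f g m%:R)))).
    by apply: ereal_sup_ubound; exists k.
  by apply: ereal_sup_ubound; exists m%:R.
by rewrite ball_averageE ?ler_nat// natrK lee_pdivrMr ?volR_gt0.
Qed.

Lemma mass_uniform_density (D : R) :
  (forall eta : R, 0 < eta -> exists m0, forall m k, (m0 <= m)%N ->
    (((D - eta) * vol m)%:E <= mass_in coef_mass m k <=
     ((D + eta) * vol m)%:E)%E) ->
  has_uniform_density dot f g D%:E.
Proof.
move=> h.
have near (eta : R) : 0 < eta -> exists r0 : R, forall r k, r0 < r ->
    ((D - eta)%:E <= ball_average dot f g r k <= (D + eta)%:E)%E.
  move=> /h[m0 hm0]; exists (maxn (\max_(j < d2) N j) m0)%:R => r k mr.
  have Nr : (\max_(j < d2) N j)%:R <= r.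
    by apply: le_trans (ltW mr); rewrite ler_nat leq_maxl.
  have r0 : 0 <= r by apply: le_trans Nr.
  have /(hm0 _ k) : (m0 <= Num.truncn r)%N.
    rewrite truncn_ge_nat//; apply: le_trans (ltW mr).
    by rewrite ler_nat leq_maxr.
  by rewrite ball_averageE// lee_pdivlMr ?volR_gt0// lee_pdivrMr ?volR_gt0.
have inf_le (eta : R) : 0 < eta -> (lower_density dot f g <= (D + eta)%:E)%E.
  move=> /near[r0 hr]; rewrite /lower_density limf_einfE.
  apply: ge_ereal_sup => _ [V [r1 [_ r1V]] <-].
  pose r := Num.max r0 r1 + 1.
  have [rr0 rr1] : r0 < r /\ r1 < r.
    by rewrite /r; split; rewrite ltr_pwDr// le_max lexx ?orbT.
  apply: (@le_trans _ _ (ereal_inf (range (ball_average dot f g r)))).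
    by apply: ereal_inf_lbound; exists r => //; exact: r1V.
  have /andP[_ ] := hr r 0 rr0; apply: le_trans.
  by apply: ereal_inf_lbound; exists 0.
have inf_ge (eta : R) : 0 < eta -> ((D - eta)%:E <= lower_density dot f g)%E.
  move=> /near[r0 hr]; rewrite /lower_density limf_einfE.
  apply: ereal_sup_ge; exists (ereal_inf
      [set ereal_inf (range (ball_average dot f g x)) | x in [set r | r0 < r]]).
    by exists [set r | r0 < r] => //; exists r0; split; rewrite ?num_real.
  apply: le_ereal_inf_tmp => _ [r /= rr0 <-].
  apply: le_ereal_inf_tmp => _ [k _ <-].
  by have /andP[] := hr r k rr0.
have sup_le (eta : R) : 0 < eta -> (upper_density dot f g <= (D + eta)%:E)%E.
  move=> /near[r0 hr]; rewrite /upper_density limf_esupE.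
  apply: ereal_inf_le; exists (ereal_sup
      [set ereal_sup (range (ball_average dot f g x)) | x in [set r | r0 < r]]).
    by exists [set r | r0 < r] => //; exists r0; split; rewrite ?num_real.
  apply: ge_ereal_sup => _ [r /= rr0 <-].
  apply: ge_ereal_sup => _ [k _ <-].
  by have /andP[] := hr r k rr0.
have sup_ge (eta : R) : 0 < eta -> ((D - eta)%:E <= upper_density dot f g)%E.
  move=> /near[r0 hr]; rewrite /upper_density limf_esupE.
  apply: le_ereal_inf_tmp => _ [V [r1 [_ r1V]] <-].
  pose r := Num.max r0 r1 + 1.
  have [rr0 rr1] : r0 < r /\ r1 < r.
    by rewrite /r; split; rewrite ltr_pwDr// le_max lexx ?orbT.
  apply: (@le_trans _ _ (ereal_sup (range (ball_average dot f g r)))); last first.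
    by apply: ereal_sup_ubound; exists r => //; exact: r1V.
  have /andP[+ _] := hr r 0 rr0; move=> /le_trans; apply.
  by apply: ereal_sup_ubound; exists 0.
have squeeze (x : \bar R) : (forall eta : R, 0 < eta ->
    ((D - eta)%:E <= x)%E /\ (x <= (D + eta)%:E)%E) -> x = D%:E.
  move=> hx; apply/eqP; rewrite eq_le; apply/andP; split.
    by apply/lee_addgt0Pr => e e0; rewrite -EFinD; case: (hx e e0).
  apply/lee_addgt0Pr => e e0; have [+ _] := hx e e0.
  by rewrite EFinB leeBlDr.
split; apply: squeeze => eta eta0; split.
- exact: inf_ge.
- exact: inf_le.
- exact: sup_ge.
- exact: sup_le.
Qed.

End Densities.

(** * Envelopes and almost orthogonality *)

Section Majorants.
Context (R : realType) (d1 d2 : nat) (N : 'I_d2 -> nat).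
Local Notation G := (index_group d1 N).
Implicit Types (r rho : G -> R).

Definition majorant r : Prop :=
  (forall x, 0 <= r x) /\ (\esum_(x in [set: G]) (r x)%:E < +oo)%E.

Lemma majorant_abs r : summable [set: G] (fun n => (r n)%:E) ->
  majorant (fun x => `|r x|).
Proof.
by move=> rS; split => //; apply: le_lt_trans rS.
Qed.

Lemma majorantZ (c : R) r : 0 <= c -> majorant r -> majorant (fun x => c * r x).
Proof.
move=> c0 [r0 roo]; split => [x|]; first exact: mulr_ge0.
under eq_esum do rewrite EFinM.
rewrite esumZl//; last by move=> x _; rewrite lee_fin.
by apply: lte_mul_pinfty => //.
Qed.

(** A summable function is bounded by its sum. *)
Lemma majorant_sqr r : majorant r -> majorant (fun x => r x ^+ 2).
Proof.
move=> rM; have [r0 roo] := rM; pose S := (\esum_(x in [set: G]) (r x)%:E)%E.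
have r0' x : (0 <= (r x)%:E)%E by rewrite lee_fin.
have S0 : (0 <= S)%E by apply: esum_ge0.
have Sfin : S \is a fin_num by rewrite ge0_fin_numE.
have rS x : r x <= fine S.
  rewrite -lee_fin fineK// -(esum_set1 (a := fun x => (r x)%:E) (t := x))//.
  exact: subset_esum.
have [_] := majorantZ (fine_ge0 S0) rM; split => [x|]; first exact: sqr_ge0.
apply: le_lt_trans b; apply: le_esum => x _.
by rewrite lee_fin expr2 ler_wpM2r.
Qed.

(** The correlations below are built as extended reals; summability makes their
    values finite. *)
Lemma majorant_fine (phi : G -> \bar R) : (forall x, 0 <= phi x)%E ->
  (\esum_(x in [set: G]) phi x < +oo)%E ->
  majorant (fun x => fine (phi x)) /\ forall x, (fine (phi x))%:E = phi x.
Proof.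
move=> phi0 phioo.
have phiE x : (fine (phi x))%:E = phi x.
  rewrite fineK// ge0_fin_numE//; apply: le_lt_trans phioo.
  by rewrite -(esum_set1 (a := phi) (t := x))//; apply: subset_esum.
split=> //; split => [x|]; first exact: fine_ge0.
by under eq_esum do rewrite phiE.
Qed.

Lemma esum_shift (phi : G -> \bar R) k :
  (\esum_(x in [set: G]) phi (x + k)%R = \esum_(x in [set: G]) phi x)%E.
Proof. by rewrite -(esum_translate phi (- k)) opprK. Qed.

(** The envelope of Gram entries in coefficient space: by
    [autocorrelation_sub], the correlation of two translates of [r] depends on
    the difference of the translations only. *)
Definition autocorrelation r (x : G) : \bar R :=
  (\esum_(n in [set: G]) ((r n)%:E * (r (n + x)%R)%:E))%E.

Lemma autocorrelation_majorant r : majorant r ->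
  majorant (fun x => fine (autocorrelation r x)) /\
  forall x, (fine (autocorrelation r x))%:E = autocorrelation r x.
Proof.
move=> [r0 roo]; have r0' x : (0 <= (r x)%:E)%E by rewrite lee_fin.
apply: majorant_fine => [x|]; first by apply: esum_ge0 => n _; rewrite mule_ge0.
rewrite exchange_esum => [|x n]; last by rewrite mule_ge0.
have S0 : (0 <= \esum_(x in [set: G]) (r x)%:E)%E by apply: esum_ge0.
have Sfin : (\esum_(x in [set: G]) (r x)%:E)%E \is a fin_num by rewrite ge0_fin_numE.
have -> : (\esum_(n in [set: G]) \esum_(x in [set: G]) ((r n)%:E * (r (n + x)%R)%:E) =
   \esum_(n in [set: G]) ((fine (\esum_(x in [set: G]) (r x)%:E))%:E * (r n)%:E))%E.
  apply: eq_esum => n _; rewrite esumZl// fineK// muleC.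
  by congr (_ * _)%E; rewrite -[RHS](esum_shift _ n); apply: eq_esum => x _; rewrite addrC.
by rewrite esumZl ?fine_ge0//; apply: lte_mul_pinfty => //; rewrite lee_fin fine_ge0.
Qed.

Lemma autocorrelation_sub r (k l : G) :
  autocorrelation r (k - l) =
  (\esum_(n in [set: G]) ((r (n - k)%R)%:E * (r (n - l)%R)%:E))%E.
Proof.
rewrite -[RHS](esum_shift _ k) /autocorrelation; apply: eq_esum => n _.
by rewrite addrK addrA.
Qed.

(** The analogue of [autocorrelation] for vectors expanded in a frame whose own
    Gram entries have the envelope [r']. *)
Definition correlation3 r r' (x : G) : \bar R :=
  (\esum_(n in [set: G]) \esum_(m in [set: G])
    ((r n)%:E * ((r m)%:E * (r' (n - m + x)%R)%:E)))%E.

Lemma correlation3_majorant r r' : majorant r -> majorant r' ->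
  majorant (fun x => fine (correlation3 r r' x)) /\
  forall x, (fine (correlation3 r r' x))%:E = correlation3 r r' x.
Proof.
move=> [r0 roo] [r'0 r'oo].
have e0 x : (0 <= (r x)%:E)%E by rewrite lee_fin.
have e'0 x : (0 <= (r' x)%:E)%E by rewrite lee_fin.
have t0 n m x : (0 <= (r n)%:E * ((r m)%:E * (r' (n - m + x)%R)%:E))%E.
  by rewrite !mule_ge0.
apply: majorant_fine => [x|].
  by apply: esum_ge0 => n _; apply: esum_ge0.
rewrite exchange_esum => [|x n]; last exact: esum_ge0.
pose S := fine (\esum_(x in [set: G]) (r x)%:E)%E.
pose S' := fine (\esum_(x in [set: G]) (r' x)%:E)%E.
have S0 : 0 <= S by apply/fine_ge0/esum_ge0.
have S'0 : 0 <= S' by apply/fine_ge0/esum_ge0.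
have SE : (\esum_(x in [set: G]) (r x)%:E)%E = S%:E.
  by rewrite fineK// ge0_fin_numE// esum_ge0.
have S'E : (\esum_(x in [set: G]) (r' x)%:E)%E = S'%:E.
  by rewrite fineK// ge0_fin_numE// esum_ge0.
have inner n : (\esum_(x in [set: G]) \esum_(m in [set: G])
    ((r n)%:E * ((r m)%:E * (r' (n - m + x)%R)%:E)) = (S * S')%:E * (r n)%:E)%E.
  rewrite exchange_esum//.
  under eq_esum => m _.
    rewrite esumZl//; last by move=> x _; rewrite mule_ge0.
    rewrite esumZl//.
    rewrite (_ : (\esum_(x in [set: G]) (r' (n - m + x)%R)%:E = S'%:E)%E); last first.
      rewrite -S'E -[RHS](esum_shift _ (n - m)).
      by apply: eq_esum => x _; rewrite addrC.
    over.
  rewrite esumZl => // [|m _]; last by rewrite mule_ge0.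
  under eq_esum do rewrite muleC.
  by rewrite esumZl// SE -!EFinM; congr _%:E; ring.
under eq_esum do rewrite inner.
by rewrite esumZl ?mulr_ge0// SE -EFinM ltry.
Qed.

Lemma correlation3_sub r r' (k l : G) :
  correlation3 r r' (k - l) = (\esum_(n in [set: G]) \esum_(m in [set: G])
    ((r (n - k)%R)%:E * ((r (m - l)%R)%:E * (r' (n - m)%R)%:E)))%E.
Proof.
rewrite -[RHS](esum_shift _ k) /correlation3; apply: eq_esum => n _.
rewrite -[RHS](esum_shift _ l); apply: eq_esum => m _.
by rewrite !addrK opprD addrACA.
Qed.

End Majorants.

Section AlmostOrthogonality.
Context (R : realType) (s : scalar_kind).
Local Notation K := (scalars R s).
Context (H : completeNormedModType K) (dot : {dot H for sconj R s}).
Hypothesis dot_norm : forall x : H, `|x| ^+ 2 = dot x x.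
Context (d1 d2 : nat) (N : 'I_d2 -> nat).
Local Notation G := (index_group d1 N).
Context (T : choiceType) (f : T -> H) (g : G -> H).

Lemma localized_majorant : l1_localized dot f g ->
  exists r : G -> R, exists2 kappa : T -> G, majorant r &
    forall i n, rabs (dot (f i) (g n)) <= r (n - kappa i).
Proof.
case=> r rS /choice[kappa hk]; exists (fun x => `|r x|), kappa.
  exact: majorant_abs.
by move=> i n; apply: le_trans (hk i n) (ler_norm _).
Qed.

(** The quadratic form [q] is almost additive over a partition of the family
    into classes: the error only sees pairs in different classes. *)
Definition almost_orthogonal (q : H -> R) (kappa : T -> G) (rho : G -> R) :=
  forall (U : choiceType) (t : T -> U) (l : seq T) (a : T -> K),
  \sum_(p <- undup [seq t i | i <- l]) q (\sum_(i <- l | t i == p) a i *: f i)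
  <= q (\sum_(i <- l) a i *: f i) +
    \sum_(i <- l) \sum_(j <- l | t i != t j)
      rabs (a i) * rabs (a j) * rho (kappa i - kappa j).

Lemma sum_classes (V : nmodType) (U : choiceType) (t : T -> U) (l : seq T)
    (F : U -> T -> V) :
  \sum_(p <- undup [seq t i | i <- l]) \sum_(i <- l | t i == p) F p i =
  \sum_(i <- l) F (t i) i.
Proof.
under eq_bigr do rewrite big_mkcond.
rewrite exchange_big /= big_seq [RHS]big_seq; apply: eq_bigr => i il.
rewrite (bigD1_seq (t i)) ?undup_uniq ?mem_undup ?map_f//= eqxx.
by rewrite big1 ?addr0// => p /negPf; rewrite eq_sym => ->.
Qed.

(** Diagonal blocks are kept exactly; only the other entries are replaced by
    their absolute values. *)
Lemma gram_split (U : choiceType) (t : T -> U) (l : seq T) (h : T -> T -> K) :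
  \sum_(p <- undup [seq t i | i <- l])
    sre (\sum_(i <- l | t i == p) \sum_(j <- l | t j == p) h i j) <=
  sre (\sum_(i <- l) \sum_(j <- l) h i j) +
    \sum_(i <- l) \sum_(j <- l | t i != t j) rabs (h i j).
Proof.
under eq_bigr do rewrite sre_sum.
rewrite sum_classes sre_sum -big_split /=; apply: ler_sum => i _.
rewrite [X in _ <= sre X + _](bigID (fun j => t j == t i)) /= sreD -addrA lerDl.
under [X in sre X]eq_bigl do rewrite eq_sym.
rewrite sre_sum -big_split /=; apply: sumr_ge0 => j _.
by rewrite -lerBlDr sub0r lerNl -sreN -rabsN sre_le_rabs.
Qed.

Lemma almost_orthogonal_norm (kappa : T -> G) (rho : G -> R) :
  (forall i j, rabs (dot (f i) (f j)) <= rho (kappa i - kappa j)) ->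
  almost_orthogonal (fun x => rnorm x ^+ 2) kappa rho.
Proof.
move=> hrho U t l a; pose h i j := a i * (sconj R s (a j) * dot (f i) (f j)).
have normE (P : pred T) : rnorm (\sum_(i <- l | P i) a i *: f i) ^+ 2 =
    sre (\sum_(i <- l | P i) \sum_(j <- l | P j) h i j).
  rewrite (rnorm_sqr dot_norm) dot_suml; congr sre; apply: eq_bigr => i _.
  rewrite dotZl dot_sumr mulr_sumr; apply: eq_bigr => j _.
  by rewrite dotZr.
under eq_bigr do rewrite normE.
rewrite normE; apply: le_trans (gram_split t l h) _; rewrite lerD2l.
apply: ler_sum => i _; apply: ler_sum => j _.
by rewrite /h !rabsM rabs_sconj -mulrA !ler_wpM2l ?rabs_ge0.
Qed.

(** The splitting is applied to each coordinate <x, g_n> separately and then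
    summed over n. *)
Lemma almost_orthogonal_mass (kappa : T -> G) (r : G -> R) (B : R) :
  majorant r -> bessel dot g B ->
  (forall i n, rabs (dot (f i) (g n)) <= r (n - kappa i)) ->
  almost_orthogonal (fun x => fine (l2_mass dot x g)) kappa
    (fun x => fine (autocorrelation r x)).
Proof.
move=> rM gB hr U t l a; have [_ rhoE] := autocorrelation_majorant rM.
have [r0 _] := rM.
have sq0 x n : (0 <= (rabs (dot x (g n)) ^+ 2)%:E)%E by rewrite lee_fin sqr_ge0.
have massE x : ((fine (l2_mass dot x g))%:E = l2_mass dot x g)%E.
  rewrite fineK// ge0_fin_numE; last exact: esum_ge0.
  exact: le_lt_trans (gB x) (ltry _).
rewrite -lee_fin EFinD -!sumEFin massE.
under eq_bigr do rewrite massE.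
rewrite /l2_mass -esum_sum//.
pose e i j n := rabs (a i) * rabs (a j) *
  (rabs (dot (f i) (g n)) * rabs (dot (f j) (g n))).
have e0 i j n : (0 <= (e i j n)%:E)%E by rewrite lee_fin !mulr_ge0 ?rabs_ge0.
apply: (@le_trans _ _ (\esum_(n in [set: G])
  ((rabs (dot (\sum_(i <- l) a i *: f i) (g n)) ^+ 2)%:E +
   \sum_(i <- l) \sum_(j <- l | t i != t j) (e i j n)%:E))%E).
  apply: le_esum => n _; rewrite sumEFin.
  under [X in (_ + X)%E]eq_bigr do rewrite sumEFin.
  rewrite sumEFin -EFinD lee_fin.
  pose c i := a i * dot (f i) (g n).
  have dotE (P : pred T) : rabs (dot (\sum_(i <- l | P i) a i *: f i) (g n)) ^+ 2 =
      sre (\sum_(i <- l | P i) \sum_(j <- l | P j) c i * sconj R s (c j)).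
    rewrite -sre_mul_sconj dot_suml; congr sre.
    rewrite rmorph_sum mulr_suml; apply: eq_bigr => i _.
    by rewrite mulr_sumr; apply: eq_bigr => j _; rewrite !dotZl.
  under eq_bigr do rewrite dotE.
  rewrite dotE; apply: le_trans (gram_split t l _) _; rewrite lerD2l.
  apply: ler_sum => i _; apply: ler_sum => j _.
  by rewrite /e /c rabsM rabs_sconj !rabsM mulrACA.
rewrite esumD//; last by move=> n _; apply: sume_ge0 => i _; apply: sume_ge0.
rewrite leeD2l// esum_sum => [|n i _ _]; last exact: sume_ge0.
apply: lee_sum => i _; rewrite esum_sum// -sumEFin.
apply: lee_sum => j _; under eq_esum do rewrite EFinM.
rewrite esumZl ?mulr_ge0 ?rabs_ge0//; last by move=> n _; rewrite lee_fin mulr_ge0 ?rabs_ge0.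
rewrite [X in (_ <= X)%E]EFinM rhoE lee_wpmul2l ?lee_fin ?mulr_ge0 ?rabs_ge0//.
rewrite autocorrelation_sub; apply: le_esum => n _.
by rewrite -EFinM lee_fin ler_pM ?rabs_ge0.
Qed.

Lemma dual_gram_le (kappa : T -> G) (r r' : G -> R) (A B : R) :
  frame_with_bounds dot g A B -> majorant r -> majorant r' ->
  (forall i n, rabs (dot (f i) (g n)) <= r (n - kappa i)) ->
  (forall k k', rabs (dot (dual_frame dot g k) (dual_frame dot g k')) <= r' (k - k')) ->
  forall i j, rabs (dot (f i) (f j)) <= fine (correlation3 r r' (kappa i - kappa j)).
Proof.
move=> gF rM r'M hr hr' i j; have [_ rhoE] := correlation3_majorant rM r'M.
have [r0 _] := rM; have [r'0 _] := r'M.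
rewrite -lee_fin rhoE correlation3_sub.
apply: le_trans (dual_dot_le dot_norm gF _ _) _.
apply: le_esum => n _; apply: le_esum => m _.
by rewrite -!EFinM lee_fin mulrA !ler_pM ?mulr_ge0 ?rabs_ge0.
Qed.

End AlmostOrthogonality.

(** * Densities of localized families *)

Lemma esum1_val (R : realType) (T : choiceType) (J : set T) (P : pred T) :
  (\esum_(j in [set j : J | P (val j)]) 1 =
   \esum_(i in [set i | J i /\ P i]) 1 :> \bar R)%E.
Proof.
rewrite (reindex_esum [set j : J | P (val j)] _ val)//; split.
- by move=> j Pj; split => //; exact/set_mem/(valP j).
- by move=> i j _ _; exact: val_inj.
- by move=> i [Ji Pi]; exists (exist _ i (mem_set Ji)).
Qed.

Lemma big_subset_if (T : eqType) (V : nmodType) (l1 l2 : seq T) (F : T -> V) :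
  uniq l1 -> uniq l2 -> {subset l2 <= l1} ->
  \sum_(i <- l1) (if i \in l2 then F i else 0) = \sum_(i <- l2) F i.
Proof.
move=> u1 u2 sub; rewrite -big_mkcond -big_filter; apply: perm_big.
apply: uniq_perm; rewrite ?filter_uniq// => i; rewrite mem_filter.
by case: (boolP (i \in l2)) => //= /sub ->.
Qed.

Section Localized.
Context (R : realType) (s : scalar_kind).
Local Notation K := (scalars R s).
Context (H : completeNormedModType K) (dot : {dot H for sconj R s}).
Hypothesis dot_norm : forall x : H, `|x| ^+ 2 = dot x x.
Context (d1 d2 : nat) (N : 'I_d2 -> nat).
Local Notation G := (index_group d1 N).
Context (g : G -> H) (A B : R) (g_frame : frame_with_bounds dot g A B).
Context (T : choiceType) (f : T -> H) (u : R) (u_gt0 : 0 < u).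
Hypothesis f_norm : forall i, u <= rnorm (f i).

Let A0 : 0 < A. Proof. by case: g_frame. Qed.

Lemma localized_mass_ge i : ((A * u ^+ 2)%:E <= l2_mass dot (f i) g)%E.
Proof.
have [_ _ /(_ (f i)) lo _] := g_frame; apply: le_trans lo.
by rewrite lee_fin ler_pM2l// ler_sqr ?nnegrE ?rnorm_ge0 ?(ltW u_gt0).
Qed.

Lemma localized_mass_gt0 i : exists2 m : R, 0 < m & l2_mass dot (f i) g = m%:E.
Proof.
have [_ _ _ /(_ (f i))] := g_frame; have := localized_mass_ge i.
case: (l2_mass _ _ _) => [m||]//; rewrite lee_fin => Am _.
by exists m => //; apply: lt_le_trans Am; rewrite mulr_gt0 ?exprn_gt0.
Qed.

Context (r : G -> R) (kappa : T -> G) (r_maj : majorant r).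
Hypothesis f_loc : forall i n, rabs (dot (f i) (g n)) <= r (n - kappa i).

Definition mass_profile (x : G) : R := (A * u ^+ 2)^-1 * r x ^+ 2.

Lemma mass_profile_majorant : majorant mass_profile.
Proof.
apply: majorantZ; last exact: majorant_sqr.
by rewrite invr_ge0 mulr_ge0 ?sqr_ge0 ?(ltW A0).
Qed.

Lemma coef_mass_le i n :
  (coef_mass dot f g i n <= (mass_profile (n - kappa i))%:E)%E.
Proof.
have [m m0 [mE ->]] := coef_massE localized_mass_gt0 i.
rewrite -EFinM lee_fin; apply: ler_pM; rewrite ?sqr_ge0 ?invr_ge0 ?(ltW m0)//.
  have := localized_mass_ge i; rewrite mE lee_fin => Am.
  by rewrite lef_pV2// posrE mulr_gt0 ?exprn_gt0.
have [r0 _] := r_maj.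
by rewrite ler_sqr ?nnegrE ?rabs_ge0.
Qed.

(** Each element leaves at least half of its mass in a fixed ball around its
    localization point, so too many elements at one point would overload
    that ball. *)
Lemma localized_multiplicity : (upper_density dot f g < +oo)%E ->
  exists2 M : R, 0 <= M &
    forall k, (\esum_(i in [set i | kappa i == k]) 1 <= M%:E)%E.
Proof.
move=> /(upper_density_mass localized_mass_gt0)[C [m0 hC]].
have [th0 thoo] := mass_profile_majorant.
have h2 : 0 < 2^-1 :> R by rewrite invr_gt0.
have [L hL] := gauge_tail th0 thoo h2.
pose m := maxn L m0.
have key k : ((2^-1)%R%:E * (\esum_(i in [set i | kappa i == k]) 1) <=
    (C * (volume d1 N m)%:R)%:E)%E.
  apply: le_trans (hC m k (leq_maxr _ _)).
  apply: (@le_trans _ _ (mass_in (coef_mass dot f g) (0 + L)%N k)).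
    apply: le_trans (mass_in_ge (coef_mass_ge0 localized_mass_gt0)
      (coef_mass_sum localized_mass_gt0) coef_mass_le 0 k _ hL); last first.
      by rewrite invf_le1// ler1n.
    have -> : 1 - 2^-1 = 2^-1 :> R by field.
    apply: lee_wpmul2l; first by rewrite lee_fin ltW.
    apply: subset_esum => // i /= /eqP ->; rewrite subrr.
    by apply/gauge_leP => j; rewrite ffunE.
  apply: le_esum => i _; apply: subset_esum => [n|n _].
    by rewrite /gauge_ball /= add0n => /leq_trans; apply; exact: leq_maxl.
  exact: (coef_mass_ge0 localized_mass_gt0).
exists (2 * (C * (volume d1 N m)%:R)) => [|k]; last first.
  by rewrite EFinM -lee_pdivrMl.
have := key 0; rewrite lee_pdivrMl// -EFinM; rewrite -lee_fin; apply: le_trans.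
exact: esum_ge0.
Qed.

Lemma localized_count (M D lambda : R) c : 0 <= M ->
  (forall k, (\esum_(i in [set i | kappa i == k]) 1 <= M%:E)%E) ->
  0 < D -> D%:E = lower_density dot f g -> 0 < lambda < 1 ->
  exists w0, forall w k, (w0 <= w)%N ->
    ((lambda * D * (volume d1 N w)%:R)%:E <= count_in R kappa (w - c) k)%E.
Proof.
move=> M0 mult D0 DE l01; have [th0 thoo] := mass_profile_majorant.
apply: (count_of_lower_mass M0 mult (coef_mass_ge0 localized_mass_gt0)
  (coef_mass_sum localized_mass_gt0) th0 thoo coef_mass_le) => // eta eta0.
apply: (lower_density_mass localized_mass_gt0).
by rewrite -DE lte_fin; lra.
Qed.

Lemma localized_uniform_density (M : R) (w k0 : nat) : 0 <= M ->
  (forall k, (\esum_(i in [set i | kappa i == k]) 1 <= M%:E)%E) ->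
  (forall p, (\esum_(i in [set i | tile w (kappa i) == p]) 1 = k0%:R%:E :> \bar R)%E) ->
  has_uniform_density dot f g (k0%:R / (volume d1 N w)%:R)%:E.
Proof.
move=> M0 mult tc; have [th0 thoo] := mass_profile_majorant.
apply: (mass_uniform_density localized_mass_gt0) => eta eta0.
exact: (tiled_mass M0 mult (coef_mass_ge0 localized_mass_gt0)
  (coef_mass_sum localized_mass_gt0) th0 thoo coef_mass_le tc eta0).
Qed.

End Localized.

(** * Selection in tiles *)

Section Selection.
Context (R : realType) (s : scalar_kind).
Local Notation K := (scalars R s).
Context (c : R -> R) (c_fri : finite_restricted_invertibility s c).
Context (H : completeNormedModType K) (dot : {dot H for sconj R s}).
Hypothesis dot_norm : forall x : H, `|x| ^+ 2 = dot x x.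
Context (d1 d2 : nat) (N : 'I_d2 -> nat).
Local Notation G := (index_group d1 N).
Context (T : choiceType) (f : T -> H) (u BF : R) (u_gt0 : 0 < u).
Hypothesis f_norm : forall i, u <= rnorm (f i).
Hypotheses (BF_gt0 : 0 < BF) (f_bessel : bessel dot f BF).
Context (kappa : T -> G) (M : R) (M0 : 0 <= M).
Hypothesis mult : forall k, (\esum_(i in [set i | kappa i == k]) 1 <= M%:E)%E.

(** Restricted invertibility is applied to the elements localized at depth at
    least [L] in the tile, of which there are at least [X]; the selection is
    then trimmed to [k0] elements, a number that does not depend on the tile. *)
Lemma tile_selection (eps X : R) (w L k0 : nat) (p : {ffun 'I_d1 -> int}) :
  0 < eps < 1 ->
  (X%:E <= count_in R kappa (w - L) (tile_center N w p))%E ->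
  (forall n, (1 - eps) * u ^+ 2 / BF * X <= n%:R -> (k0 <= n)%N) ->
  exists l : seq T, [/\ uniq l, size l = k0,
    forall i, i \in l -> (gauge (kappa i - tile_center N w p) <= w - L)%N &
    forall (b : T -> K) (l' : seq T), uniq l' -> {subset l' <= l} ->
      c eps * u ^+ 2 * (\sum_(i <- l') rabs (b i) ^+ 2) <=
      rnorm (\sum_(i <- l') b i *: f i) ^+ 2].
Proof.
move=> eps01 hX hk0; set z := tile_center N w p in hX *.
have [l0 ul0 l0E] := esum1_fin (count_in_le M0 mult (w - L) z).
have countE : count_in R kappa (w - L) z = (size l0)%:R%:E.
  rewrite -esum1_seq//; congr (esum _ _); apply/seteqP.
  by split => i /=; rewrite l0E; [exact: mem_set|exact: set_mem].
have [l1 [ul1 sub1 size1 low1]] := finite_restricted_invertibility_seq dot_norm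
  c_fri BF_gt0 eps01 u_gt0 ul0 (bessel_seq f_bessel ul0) (fun i _ => f_norm i).
have k0_le : (k0 <= size l1)%N.
  apply: hk0; apply: le_trans size1; rewrite countE lee_fin in hX.
  have e1 : 0 <= 1 - eps by case/andP: eps01; lra.
  by rewrite ler_wpM2l// divr_ge0 ?(ltW BF_gt0)// mulr_ge0 ?sqr_ge0.
exists (take k0 l1); split.
- by rewrite take_uniq.
- by rewrite size_takel.
- by move=> i /mem_take/sub1; rewrite l0E => /set_mem.
- move=> b l' ul' sub'.
  have sub'1 : {subset l' <= l1} by move=> i /sub'/mem_take.
  have := low1 (fun i => if i \in l' then b i else 0).
  rewrite -(big_subset_if (fun i => rabs (b i) ^+ 2) ul1 ul' sub'1).
  rewrite -(big_subset_if (fun i => b i *: f i) ul1 ul' sub'1).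
  have -> : \sum_(i <- l1) rabs (if i \in l' then b i else 0) ^+ 2 =
      \sum_(i <- l1) (if i \in l' then rabs (b i) ^+ 2 else 0).
    by apply: eq_bigr => i _; case: ifP => // _; rewrite rabs0 expr0n.
  have -> // : \sum_(i <- l1) (if i \in l' then b i else 0) *: f i =
      \sum_(i <- l1) (if i \in l' then b i *: f i else 0).
  by apply: eq_bigr => i _; case: ifP => // _; rewrite scale0r.
Qed.

(** By continuity of [c], a slightly smaller [eps] costs little in the Riesz
    bound; it gains room in the density. *)
Lemma smaller_eps (eps delta : R) : 0 < eps < 1 -> 0 < delta < 1 ->
  exists eps', [/\ 0 < eps' < 1, eps' < eps & (1 - delta) * c eps <= c eps'].
Proof.
move=> eps01 /andP[d0 d1']; have [cI cC _ _] := c_fri.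
have epsI : eps \in `]0, 1[ by rewrite in_itv.
have /andP[c0 _] : 0 < c eps < 1 by have := cI _ epsI; rewrite in_itv.
have dc : 0 < delta * c eps by rewrite mulr_gt0.
have /cvgrPdist_lt/(_ _ dc) := cC _ epsI.
case/nbhs_ballP => e /= e0 he.
pose t := Num.min (e / 2) (eps / 2).
have [e1 e2] := andP eps01.
have t0 : 0 < t by rewrite lt_min !divr_gt0.
have te : t <= e / 2 by rewrite ge_min lexx.
have teps : t <= eps / 2 by rewrite ge_min lexx orbT.
exists (eps - t); split; [lra|lra|].
have := he (eps - t); rewrite /ball /= opprB addrC subrK gtr0_norm//.
have tlt : t < e by lra.
by move=> /(_ tlt); rewrite ltr_norml => /andP[_]; lra.
Qed.

Context (q : H -> R) (alpha beta : R) (rho : G -> R).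
Hypotheses (alpha_gt0 : 0 < alpha) (beta_gt0 : 0 < beta).
Hypothesis q_bounds : forall x,
  alpha * rnorm x ^+ 2 <= q x <= beta * rnorm x ^+ 2.
Hypothesis rho_maj : majorant rho.
Hypothesis q_almost : almost_orthogonal f q kappa rho.

(** Schur's test: after symmetrizing the products of coefficients, the row and
    column sums of the kernel restricted to distant pairs are at most
    [M * eta]. *)
Lemma far_pairs_le (L : nat) (eta : R) (t : T -> {ffun 'I_d1 -> int})
    (l : seq T) (a : T -> K) : uniq l ->
  (\esum_(x in [set x | (L < gauge x)%N]) (rho x)%:E <= eta%:E)%E ->
  (forall i j, i \in l -> j \in l -> t i != t j -> (L < gauge (kappa i - kappa j))%N) ->
  \sum_(i <- l) \sum_(j <- l | t i != t j)
    rabs (a i) * rabs (a j) * rho (kappa i - kappa j) <=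
  M * eta * \sum_(i <- l) rabs (a i) ^+ 2.
Proof.
move=> ul tail far; have [rho0 _] := rho_maj.
pose phi x : R := if (L < gauge x)%N then rho x else 0.
have phi0 x : 0 <= phi x by rewrite /phi; case: ifP.
have phiE : (\esum_(x in [set: G]) (phi x)%:E <= eta%:E)%E.
  apply: le_trans tail; rewrite -(esum_if (fun x => L < gauge x)%N).
  by apply: le_esum => x _; rewrite /phi; case: ifP.
have row i : \sum_(j <- l) phi (kappa i - kappa j) <= M * eta.
  rewrite -lee_fin -sumEFin.
  apply: (@le_trans _ _ (\esum_(j in [set: T]) (phi (kappa i - kappa j))%:E)%E).
    exact: sum_le_esum.
  apply: le_trans (esum_kappa_le M0 mult (theta := fun x => phi (kappa i - x)) _) _ => //.
  by rewrite (esum_reflect (fun x => (phi x)%:E)) EFinM lee_wpmul2l.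
have col j : \sum_(i <- l) phi (kappa i - kappa j) <= M * eta.
  rewrite -lee_fin -sumEFin.
  apply: (@le_trans _ _ (\esum_(i in [set: T]) (phi (kappa i - kappa j))%:E)%E).
    exact: sum_le_esum.
  apply: le_trans (esum_kappa_le M0 mult (theta := fun x => phi (x - kappa j)) _) _ => //.
  by rewrite (esum_translate (fun x => (phi x)%:E)) EFinM lee_wpmul2l.
apply: (@le_trans _ _ (\sum_(i <- l) \sum_(j <- l)
    (rabs (a i) ^+ 2 / 2 * phi (kappa i - kappa j) +
     rabs (a j) ^+ 2 / 2 * phi (kappa i - kappa j)))).
  rewrite big_seq [leRHS]big_seq; apply: ler_sum => i il.
  rewrite big_mkcond big_seq [leRHS]big_seq; apply: ler_sum => j jl.
  rewrite -mulrDl; case: ifP => [tij|_]; last first.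
    by rewrite mulr_ge0// addr_ge0// divr_ge0// sqr_ge0.
  rewrite /phi (far i j il jl tij) ler_wpM2r//.
  by have := sqr_ge0 (rabs (a i) - rabs (a j)); lra.
under eq_bigr do rewrite big_split /=.
rewrite big_split /= [X in _ + X]exchange_big /=.
have -> : M * eta * \sum_(i <- l) rabs (a i) ^+ 2 =
   \sum_(i <- l) rabs (a i) ^+ 2 / 2 * (M * eta) +
   \sum_(i <- l) rabs (a i) ^+ 2 / 2 * (M * eta).
  by rewrite -!mulr_suml; field.
by apply: lerD; apply: ler_sum => i _; rewrite -mulr_sumr ler_wpM2l ?divr_ge0 ?sqr_ge0.
Qed.

(** Half of [delta] pays for replacing [eps] by [eps'] in the Riesz bound, the
    other half for the interaction between tiles. In the density, the gain from
    [eps'] pays for the layer of width [L] discarded in each tile. *)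
Lemma tiled_selection (D eps delta : R) : 0 < D -> 0 < eps < 1 -> 0 < delta < 1 ->
  (forall (lambda : R) L, 0 < lambda < 1 -> exists w0, forall w k, (w0 <= w)%N ->
    ((lambda * D * (volume d1 N w)%:R)%:E <= count_in R kappa (w - L) k)%E) ->
  exists (J : set T) (w k0 : nat), [/\
    forall p, (\esum_(i in [set i | J i /\ tile w (kappa i) == p]) 1 = k0%:R%:E :> \bar R)%E,
    (1 - eps) * u ^+ 2 / BF * D <= k0%:R / (volume d1 N w)%:R &
    forall (l : seq T) (a : T -> K), uniq l -> (forall i, i \in l -> J i) ->
      c eps * (1 - delta) * (alpha / beta) * u ^+ 2 *
        (\sum_(i <- l) rabs (a i) ^+ 2) <= rnorm (\sum_(i <- l) a i *: f i) ^+ 2].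
Proof.
move=> D0 eps01 delta01 hcount.
have [d0 d1'] := andP delta01; have [e0 e1] := andP eps01.
have delta2 : 0 < delta / 2 < 1 by lra.
have [eps' [eps'01 eps'_lt c_eps']] := smaller_eps eps01 delta2.
have [e'0 e'1] := andP eps'01.
have [cI _ _ _] := c_fri.
have /andP[c0 _] : 0 < c eps < 1.
  by have := cI eps; rewrite !in_itv /=; apply.
(* lambda is chosen so that (1 - eps') * lambda = 1 - eps *)
pose lambda := (1 - eps) / (1 - eps').
have l01 : 0 < lambda < 1.
  by rewrite divr_gt0 ?subr_gt0//= ltr_pdivrMr ?subr_gt0// mul1r; lra.
pose eta := alpha * (c eps * u ^+ 2) * (delta / 2).
have eta0 : 0 < eta.
  by rewrite /eta !mulr_gt0 ?exprn_gt0 ?divr_gt0.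
have M1 : 0 < M + 1 by rewrite ltr_wpDl.
have [rho0 rhooo] := rho_maj.
have [L hL] := gauge_tail rho0 rhooo (divr_gt0 eta0 M1).
have [w0 hw0] := hcount lambda L l01.
pose w := maxn w0 L; pose v : R := (volume d1 N w)%:R.
have v0 : 0 < v by rewrite ltr0n volume_gt0.
pose X := lambda * D * v.
have [n0 n0P] : exists n : nat, (1 - eps') * u ^+ 2 / BF * X <= n%:R.
  by exists (Num.truncn ((1 - eps') * u ^+ 2 / BF * X)).+1; exact/ltW/truncnS_gt.
(* the target density, rounded up: the selections have integer size, so
   rounding is free *)
have [k0 k0P k0min] := ex_minnP (ex_intro
  (fun n : nat => (1 - eps') * u ^+ 2 / BF * X <= n%:R) n0 n0P).
have /choice[S hS] := fun p => tile_selection eps'01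
  (hw0 w (tile_center N w p) (leq_maxl _ _)) k0min.
have S_tile p i : i \in S p -> tile w (kappa i) = p.
  have [_ _ + _] := hS p => /[apply] h; apply/eqP; rewrite tileP.
  by apply: leq_trans h (leq_subr _ _).
exists [set i | i \in S (tile w (kappa i))], w, k0; split.
- move=> p; have [uS szS _ _] := hS p.
  rewrite -szS -esum1_seq//; congr (esum _ _); apply/seteqP; split => i /=.
    by case=> + /eqP <-.
  by move=> iS; rewrite (S_tile _ _ iS).
- rewrite ler_pdivlMr//; apply: le_trans k0P.
  rewrite le_eqVlt; apply/orP; left; apply/eqP; rewrite /X /lambda -/v.
  by field; rewrite !gt_eqF// subr_gt0.
move=> l a ul lJ; pose t i := tile w (kappa i).
have far i j : i \in l -> j \in l -> t i != t j -> (L < gauge (kappa i - kappa j))%N.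
  move=> /lJ /= iS _; apply: tile_separation; first exact: leq_maxr.
  by have [_ _ + _] := hS (tile w (kappa i)); apply.
have := q_almost t l a.
have := far_pairs_le a ul hL far.
set E := \sum_(i <- l) \sum_(j <- l | _) _; set Q := \sum_(p <- undup _) _.
set n2 := \sum_(i <- l) rabs (a i) ^+ 2; set x := \sum_(i <- l) a i *: f i.
have n20 : 0 <= n2 by apply: sumr_ge0 => i _; rewrite sqr_ge0.
have Q_ge : alpha * (c eps' * u ^+ 2 * n2) <= Q.
  rewrite /n2 -(sum_classes t l (fun _ i => rabs (a i) ^+ 2)) !mulr_sumr.
  rewrite /Q; apply: ler_sum => p _.
  have /andP[+ _] := q_bounds (\sum_(i <- l | t i == p) a i *: f i).
  apply: le_trans; rewrite ler_pM2l//.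
  have [_ _ _ /(_ a [seq i <- l | t i == p])] := hS p.
  rewrite !big_filter; apply; first exact: filter_uniq.
  by move=> i; rewrite mem_filter => /andP[/eqP <- /lJ].
have /andP[_ q_le] := q_bounds x.
have Meta : M * (eta / (M + 1)) <= eta.
  by rewrite mulrA ler_pdivrMr// mulrC (ler_wpM2l (ltW eta0))// lerDl.
have h1 := ler_wpM2r n20 Meta.
have u2 : 0 < u ^+ 2 by rewrite exprn_gt0.
have h2 : alpha * ((1 - delta / 2) * c eps * u ^+ 2 * n2) <= alpha * (c eps' * u ^+ 2 * n2).
  by rewrite ler_pM2l// ler_wpM2r// ler_pM2r.
move=> hE hQ; have : alpha * (c eps * (1 - delta) * u ^+ 2 * n2) <= beta * rnorm x ^+ 2.
  rewrite /eta in h1 hE *; lra.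
rewrite -ler_pdivrMl//; apply: le_trans.
by rewrite le_eqVlt; apply/orP; left; apply/eqP; field; rewrite gt_eqF.
Qed.

End Selection.

(** * The two cases *)

Section Combination.
Context (R : realType) (s : scalar_kind).
Local Notation K := (scalars R s).
Context (c : R -> R) (c_fri : finite_restricted_invertibility s c).
Context (H : completeNormedModType K) (dot : {dot H for sconj R s}).
Hypothesis dot_norm : forall x : H, `|x| ^+ 2 = dot x x.
Context (d1 d2 : nat) (N : 'I_d2 -> nat).
Local Notation G := (index_group d1 N).
Context (g : G -> H) (A B : R) (g_frame : frame_with_bounds dot g A B).
Context (T : choiceType) (f : T -> H) (u BF : R) (u_gt0 : 0 < u).
Hypothesis f_norm : forall i, u <= rnorm (f i).
Hypothesis f_bessel : bessel dot f BF.
Hypothesis density_gt0 : (0 < lower_density dot f g)%E.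
Hypothesis density_le : (lower_density dot f g <= upper_density dot f g)%E.
Hypothesis density_fin : (upper_density dot f g < +oo)%E.
Context (r : G -> R) (kappa : T -> G) (r_maj : majorant r).
Hypothesis f_loc : forall i n, rabs (dot (f i) (g n)) <= r (n - kappa i).

(** An empty family has density zero. *)
Lemma family_inhabited : exists i : T, True.
Proof.
apply: contrapT => noT; have mass_gt0 := localized_mass_gt0 g_frame u_gt0 f_norm.
have [D [D0 Dlt]] : exists D : R, 0 < D /\ (D%:E < lower_density dot f g)%E.
  move: density_gt0; case: (lower_density _ _ _) => [D||]//.
    by rewrite lte_fin => D0; exists (D / 2); rewrite divr_gt0// lte_fin; split=> //; lra.
  by exists 1; rewrite ltry.
have [m0 /(_ m0 0 (leqnn _))] := lower_density_mass mass_gt0 Dlt.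
rewrite /mass_in esum1 => [|i _]; last by case: noT; exists i.
by rewrite lee_fin leNgt mulr_gt0// volR_gt0.
Qed.

(** The Bessel inequality, tested on an element of the family. *)
Lemma sqr_norm_le_bessel : u ^+ 2 <= BF.
Proof.
have [i _] := family_inhabited.
have := bessel_seq f_bessel (isT : uniq [:: i]) (f i).
rewrite big_seq1 dotxx// rabs_emb ?sqr_ge0// => h.
have ui : u ^+ 2 <= rnorm (f i) ^+ 2.
  by rewrite ler_sqr ?nnegrE ?rnorm_ge0 ?(ltW u_gt0).
have n0 : 0 < rnorm (f i) ^+ 2 by apply: lt_le_trans ui; rewrite exprn_gt0.
by apply: le_trans ui _; rewrite -(ler_pM2r n0) -expr2.
Qed.

Context (q : H -> R) (alpha beta : R) (rho : G -> R).
Hypotheses (alpha_gt0 : 0 < alpha) (beta_gt0 : 0 < beta).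
Hypothesis q_bounds : forall x,
  alpha * rnorm x ^+ 2 <= q x <= beta * rnorm x ^+ 2.
Hypothesis rho_maj : majorant rho.
Hypothesis q_almost : almost_orthogonal f q kappa rho.

(** The common core of both cases, which differ only in the quadratic form. *)
Lemma uniform_riesz_subfamily (eps delta : R) : 0 < eps < 1 -> 0 < delta < 1 ->
  exists (J : set T) (D : \bar R),
    [/\ has_uniform_density dot (subfamily f J) g D,
        relative_upper_density dot f g J = (D / lower_density dot f g)%E,
        (((1 - eps) * u ^+ 2 / BF)%:E <= relative_upper_density dot f g J)%E &
        riesz_sequence (subfamily f J)
          (c eps * (1 - delta) * (alpha / beta) * u ^+ 2) BF].
Proof.
move=> eps01 delta01.
have u2 : 0 < u ^+ 2 by rewrite exprn_gt0.
have uB := sqr_norm_le_bessel; have B0 : 0 < BF by apply: lt_le_trans uB.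
have [D DE] : exists D : R, lower_density dot f g = D%:E.
  move: density_gt0 (le_lt_trans density_le density_fin).
  by case: (lower_density _ _ _) => [D||]// _ _; exists D.
have D0 : 0 < D by rewrite -lte_fin -DE.
have [M M0 mult] := localized_multiplicity g_frame u_gt0 f_norm r_maj f_loc density_fin.
have [J [w [k0 [tile_count dens low]]]] := tiled_selection c_fri dot_norm u_gt0
  f_norm B0 f_bessel M0 mult alpha_gt0 beta_gt0 q_bounds rho_maj q_almost
  D0 eps01 delta01 (fun lambda L =>
    localized_count g_frame u_gt0 f_norm r_maj f_loc L M0 mult D0 (esym DE)).
pose D' : R := k0%:R / (volume d1 N w)%:R.
have unif : has_uniform_density dot (subfamily f J) g D'%:E.
  apply: (localized_uniform_density g_frame u_gt0
    (fun j : J => f_norm (val j)) r_maj (kappa := fun j : J => kappa (val j))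
    (fun j : J => f_loc (val j)) M0) => [k|p].
    rewrite (esum1_val R J (fun i => kappa i == k)).
    by apply: le_trans (mult k); apply: subset_esum => // i /= [].
  by rewrite (esum1_val R J (fun i => tile w (kappa i) == p)).
have relE : relative_upper_density dot f g J = (D'%:E / lower_density dot f g)%E.
  by rewrite /relative_upper_density; case: unif => _ ->.
exists J, D'%:E; split => //.
  rewrite relE DE inver gt_eqF// -EFinM lee_fin ler_pdivlMr//.
have [cI _ _ _] := c_fri.
have /andP[c0 c1] : 0 < c eps < 1.
  by have := cI eps; rewrite !in_itv /=; apply.
have [d0 d1'] := andP delta01.
have ab : alpha / beta <= 1.
  have [i _] := family_inhabited; have /andP[qa qb] := q_bounds (f i).
  rewrite ler_pdivrMr// mul1r; have := le_trans qa qb.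
  by rewrite ler_pM2r// exprn_gt0// (lt_le_trans u_gt0).
have ab0 : 0 < alpha / beta by rewrite divr_gt0.
have cd0 : 0 < c eps * (1 - delta) by rewrite mulr_gt0// subr_gt0.
apply: subfamily_riesz_sequence.
- by do 2 rewrite mulr_gt0//.
- apply: le_trans uB; rewrite ler_piMl ?(ltW u2)//.
  rewrite mulr_ile1 ?(ltW ab0) ?(ltW cd0)//.
  by rewrite mulr_ile1 ?(ltW c0) ?(ltW c1)//; lra.
move=> l a ul lJ; rewrite low//=; exact: (bessel_synth dot_norm).
Qed.

End Combination.

Theorem theorem3p10 (R : realType) (s : scalar_kind)
  (c : R -> R) (c_fri : finite_restricted_invertibility s c)
  (H : completeNormedModType (scalars R s)) (dot : {dot H for sconj R s})
  (dot_norm : forall x : H, `|x| ^+ 2 = dot x x)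
  (d1 d2 : nat) (N : 'I_d2 -> nat) (N_gt0 : forall j, (0 < N j)%N)
  (g : index_group d1 N -> H) (g_frame : is_frame dot g)
  (I : countType) (f : I -> H) (f_localized : l1_localized dot f g)
  (u : R) (u_gt0 : 0 < u) (f_norm : forall i, u <= rnorm (f i))
  (BF : R) (f_bessel : bessel dot f BF)
  (density_gt0 : (0 < lower_density dot f g)%E)
  (density_le : (lower_density dot f g <= upper_density dot f g)%E)
  (density_fin : (upper_density dot f g < +oo)%E) :
  (forall (AG BG : R), riesz_basis g AG BG ->
    forall eps delta : R, 0 < eps < 1 -> 0 < delta < 1 ->
    exists (J : set I) (D : \bar R),
      [/\ has_uniform_density dot (subfamily f J) g D,
          relative_upper_density dot f g J = (D / lower_density dot f g)%E,
          (((1 - eps) * u ^+ 2 / BF)%:E <= relative_upper_density dot f g J)%E &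
          riesz_sequence (subfamily f J)
            (c eps * (1 - delta) * (AG / BG) * u ^+ 2) BF])
  /\
  (l1_self_localized dot (dual_frame dot g) ->
    forall eps delta : R, 0 < eps < 1 -> 0 < delta < 1 ->
    exists (J : set I) (D : \bar R),
      [/\ has_uniform_density dot (subfamily f J) g D,
          relative_upper_density dot f g J = (D / lower_density dot f g)%E,
          (((1 - eps) * u ^+ 2 / BF)%:E <= relative_upper_density dot f g J)%E &
          riesz_sequence (subfamily f J)
            (c eps * (1 - delta) * u ^+ 2) BF]).
Proof.
have [A [B gF]] := g_frame.
have [r [kappa r_maj f_loc]] := localized_majorant f_localized.
split=> [AG BG gR|dual_loc] eps delta eps01 delta01.
  have gF' := riesz_basis_frame dot_norm gR; have [AG0 AB lo up] := gF'.
  have [rho_maj _] := autocorrelation_majorant r_maj.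
  apply: (uniform_riesz_subfamily c_fri dot_norm gF' u_gt0 f_norm f_bessel
    density_gt0 density_le density_fin r_maj f_loc AG0 (lt_le_trans AG0 AB)
    (q := fun x => fine (l2_mass dot x g)) _ rho_maj
    (almost_orthogonal_mass r_maj up f_loc)) => // x.
  have mass0 : (0 <= l2_mass dot x g)%E.
    by apply: esum_ge0 => n _; rewrite lee_fin sqr_ge0.
  have massE : (fine (l2_mass dot x g))%:E = l2_mass dot x g.
    by rewrite fineK// ge0_fin_numE// (le_lt_trans (up x))// ltry.
  by rewrite -!lee_fin massE lo up.
have [r' r'_sum r'_loc] := dual_loc.
have r'_maj := majorant_abs r'_sum.
have [rho_maj _] := correlation3_majorant r_maj r'_maj.
have gram := dual_gram_le dot_norm gF r_maj r'_maj f_loc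
  (fun k k' => le_trans (r'_loc k k') (ler_norm _)).
have q_bounds (x : H) : 1 * rnorm x ^+ 2 <= rnorm x ^+ 2 <= 1 * rnorm x ^+ 2.
  by rewrite mul1r lexx.
have := uniform_riesz_subfamily c_fri dot_norm gF u_gt0 f_norm f_bessel
  density_gt0 density_le density_fin r_maj f_loc ltr01 ltr01 q_bounds rho_maj
  (almost_orthogonal_norm dot_norm gram) eps01 delta01.
by rewrite divr1 mulr1.
Qed.
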